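(* There is a randomized polynomial-time algorithm that, given a graph $G=(V,E)$ with edge lengths $\ell_G:E\to\mathbb{R}_{\ge 0}$ and terminals $K\subseteq V$ such that the shortest-path metric $d_G$ is $\beta$-decomposable, produces a (random) connected $0$-extension $f:V\to K$ such that for all $u,v\in V$, $$\mathbb{E}\big[d_{H}(f(u),f(v))\big]\le O(\beta\log\beta)\cdot d_G(u,v),$$ where $H=H_f$.
   Context: $d_G:V\times V\to\mathbb{R}_{\ge0}$ denotes shortest-path distance in $(G,\ell_G)$ (in particular $G$ is connected). A retraction is a map $f:V\to K$ with $f(x)=x$ for all $x\in K$. Here a $0$-extension is a retraction $f$ together with the graph $H_f=(K,E_f)$, $E_f=\{(f(u),f(v)):(u,v)\in E\}$, with edge lengths $\ell_{H_f}(x,y)=d_G(x,y)$ for $(x,y)\in E_f$; $d_{H_f}$ is its shortest-path distance. The $0$-extension $f$ is connected if for every $x\in K$ the set $f^{-1}(x)$ induces a connected subgraph of $G$. A partition $P$ of a metric space $(X,d)$ into disjoint clusters is $\Delta$-bounded if $\max_{u,v\in S}d(u,v)\le\Delta$ for every cluster $S\in P$. The metric $(X,d)$ is $\beta$-decomposable if for every $\Delta>0$ there is a polynomial-time algorithm to sample from a probability distribution $\mu$ over partitions of $X$ such that: every $P\in\mathrm{supp}(\mu)$ is $\Delta$-bounded; and for all $u,v\in X$, $\Pr_{P\sim\mu}[\exists S\in P:\ u\in S,\ v\notin S]\le\beta\, d(u,v)/\Delta$. The $O(\beta\log\beta)$ hides an absolute constant, with the convention $\beta\ge 2$. *)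

(* Defs.v *)
From Stdlib Require List.
From mathcomp Require Import all_boot all_order all_algebra.
From mathcomp Require Import classical_sets reals exp.

Set Implicit Arguments.
Unset Strict Implicit.
Unset Printing Implicit Defensive.
Import Order.TTheory GRing.Theory Num.Theory.
Local Open Scope ring_scope.

(** * Weighted graphs and shortest-path distance *)

Record wgraph (R : realType) (T : finType) :=
  WGraph { edge : rel T; len : T -> T -> R }.

Definition simple_wgraph (R : realType) (T : finType) (G : wgraph R T) : Prop :=
  [/\ symmetric (edge G), irreflexive (edge G),
      forall u v, edge G u v -> len G u v = len G v u &
      forall u v, edge G u v -> 0 <= len G u v].

Definition connected_graph (T : finType) (e : rel T) : Prop :=
  forall u v, connect e u v.

Fixpoint walk_len (R : realType) (T : finType) (l : T -> T -> R)
    (x : T) (p : seq T) : R :=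
  if p is y :: p' then l x y + walk_len l y p' else 0.

(* When [y] is unreachable from [x] the infimum is over the empty set, so the
   value is meaningful for connected graphs only. *)
Definition dist (R : realType) (T : finType) (G : wgraph R T) (x y : T) : R :=
  inf [set r | exists p, [/\ path (edge G) x p, last x p = y
                           & r = walk_len (len G) x p]]%classic.

(** * 0-extensions *)

Definition retraction (T : finType) (K : {set T}) (f : T -> T) : Prop :=
  (forall u, f u \in K) /\ (forall x, x \in K -> f x = x).

Definition fibers_connected (T : finType) (e : rel T) (K : {set T})
    (f : T -> T) : Prop :=
  forall x, x \in K -> forall u v, f u = x -> f v = x ->
    connect [rel a b | [&& e a b, f a == x & f b == x]] u v.

Definition connected_0extension (R : realType) (T : finType) (G : wgraph R T)
    (K : {set T}) (f : T -> T) : Prop :=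
  retraction K f /\ fibers_connected (edge G) K f.

(* The graph H_f is carried by the whole of [T]; if [f] is a retraction onto
   [K], all its edges lie inside [K], so the other vertices are isolated and
   the distances between terminals are those of the graph on [K]. *)
Definition ext_graph (R : realType) (T : finType) (G : wgraph R T)
    (f : T -> T) : wgraph R T :=
  WGraph
    [rel x y | [exists u, exists v, [&& edge G u v, f u == x & f v == y]]]
    (dist G).

(** * Decomposable metrics *)

Record fdist (R : realType) (A : finType) := FDist {
  pmf :> A -> R;
  pmf_ge0 : forall a, 0 <= pmf a;
  pmf_sum1 : \sum_a pmf a = 1 }.

(* A sampling procedure for partitions of [T]: for each scale, the law of the
   random partition and an upper bound on the time taken to draw it. *)
Record sampler (R : realType) (T : finType) := Sampler {
  law : R -> fdist R {set {set T}};
  sample_time : R -> nat }.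

Definition bounded_partition (R : realType) (T : finType) (d : T -> T -> R)
    (Delta : R) (P : {set {set T}}) : Prop :=
  finset.partition P [set: T] /\
  forall S, S \in P -> forall u v, u \in S -> v \in S -> d u v <= Delta.

Definition separates (T : finType) (P : {set {set T}}) (u v : T) : bool :=
  [exists S in P, (u \in S) && (v \notin S)].

(* [S] witnesses that [d] is [beta]-decomposable, each draw taking time at most
   [t]. *)
Definition decomposes_within (R : realType) (T : finType) (t : nat)
    (d : T -> T -> R) (beta : R) (S : sampler R T) : Prop :=
  forall Delta : R, 0 < Delta ->
  [/\ (sample_time S Delta <= t)%N,
      forall P, 0 < law S Delta P -> bounded_partition d Delta P &
      forall u v, \sum_(P | separates P u v) law S Delta P
                    <= beta * d u v / Delta].

(** * Randomized algorithms

   A unit-cost random access machine over two memories, one of natural numbers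
   and one of reals, presented as a structured language.  Memory is divided
   into two-dimensional arrays; an array name is fixed in the program text
   while the two indices are computed.  The only arithmetic on either memory is
   addition and subtraction, and the only numerals are natural numbers: with
   unit-cost multiplication, numbers of exponentially many bits could be
   produced in polynomially many steps.  An expression is evaluated in one
   step, as its size is fixed by the program. *)

Inductive nexp :=
  | NConst of nat
  | NGet of nat & nexp & nexp
  | NAdd of nexp & nexp
  | NSub of nexp & nexp.

Inductive rexp :=
  | RGet of nat & nexp & nexp
  | RAdd of rexp & rexp
  | RSub of rexp & rexp.

Inductive bexp :=
  | NLe of nexp & nexp
  | RLe of rexp & rexp
  | BNot of bexp
  | BAnd of bexp & bexp.

Inductive cmd :=
  | Skip
  | NSet of nat & nexp & nexp & nexp
  | RSet of nat & nexp & nexp & rexp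
  | Flip of nat & nexp & nexp
  | Sample of nat & rexp
  | Seq of cmd & cmd
  | If of bexp & cmd & cmd
  | While of bexp & cmd.

Record store (R : realType) := Store {
  nmem : nat -> nat -> nat -> nat;
  rmem : nat -> nat -> nat -> R }.

Definition upd (X : Type) (m : nat -> nat -> nat -> X) (a i j : nat) (x : X) :
    nat -> nat -> nat -> X :=
  fun a' i' j' =>
    if [&& a' == a, i' == i & j' == j]%N then x else m a' i' j'.

Definition nset (R : realType) (s : store R) (a i j k : nat) : store R :=
  Store (upd (nmem s) a i j k) (rmem s).

Definition rset (R : realType) (s : store R) (a i j : nat) (x : R) : store R :=
  Store (nmem s) (upd (rmem s) a i j x).

Fixpoint neval (R : realType) (s : store R) (e : nexp) : nat :=
  match e with
  | NConst k => k
  | NGet a e1 e2 => nmem s a (neval s e1) (neval s e2)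
  | NAdd e1 e2 => (neval s e1 + neval s e2)%N
  | NSub e1 e2 => (neval s e1 - neval s e2)%N
  end.

Fixpoint reval (R : realType) (s : store R) (e : rexp) : R :=
  match e with
  | RGet a e1 e2 => rmem s a (neval s e1) (neval s e2)
  | RAdd e1 e2 => reval s e1 + reval s e2
  | RSub e1 e2 => reval s e1 - reval s e2
  end.

Fixpoint beval (R : realType) (s : store R) (b : bexp) : bool :=
  match b with
  | NLe e1 e2 => (neval s e1 <= neval s e2)%N
  | RLe e1 e2 => reval s e1 <= reval s e2
  | BNot b1 => ~~ beval s b1
  | BAnd b1 b2 => beval s b1 && beval s b2
  end.

(* Array [a] receives the incidence matrix of "lie in a common cluster". *)
Definition write_partition (R : realType) (n : nat) (s : store R) (a : nat)
    (P : {set {set 'I_n}}) : store R :=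
  Store
    (fun a' i j =>
       if [&& a' == a, i < n & j < n]%N then
         nat_of_bool [exists u : 'I_n, exists v : 'I_n,
           [&& u == i :> nat, v == j :> nat
             & [exists S in P, (u \in S) && (v \in S)]]]
       else nmem s a' i j)
    (rmem s).

(* A finitely supported law on results, as a list of (probability, result)
   pairs; the result of a computation is its running time and final store. *)
Definition outcomes (R : realType) := seq (R * (nat * store R)).

Definition ticks (R : realType) (k : nat) (D : outcomes R) : outcomes R :=
  [seq (o.1, ((k + o.2.1)%N, o.2.2)) | o <- D].

Definition chain (R : realType) (D : outcomes R)
    (F : R * (nat * store R) -> outcomes R) : outcomes R :=
  flatten [seq [seq (o.1 * o'.1, ((o.2.1 + o'.2.1)%N, o'.2.2)) | o' <- F o]
          | o <- D].

(* [exec S c s D]: every run of [c] from [s] terminates, and [D] is the law of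
   running time and final store.  Draws from [S] are made at positive scales
   only and are independent of each other and of the coin flips; a draw is
   charged the time taken by the sampler and the time to write the answer. *)
Inductive exec (R : realType) (n : nat) (S : sampler R 'I_n) :
    cmd -> store R -> outcomes R -> Prop :=
  | exec_skip s :
      exec S Skip s [:: (1, (1%N, s))]
  | exec_nset a e1 e2 e s :
      exec S (NSet a e1 e2 e) s
        [:: (1, (1%N, nset s a (neval s e1) (neval s e2) (neval s e)))]
  | exec_rset a e1 e2 e s :
      exec S (RSet a e1 e2 e) s
        [:: (1, (1%N, rset s a (neval s e1) (neval s e2) (reval s e)))]
  | exec_flip a e1 e2 s :
      exec S (Flip a e1 e2) s
        [seq (2^-1, (1%N, nset s a (neval s e1) (neval s e2) (nat_of_bool b)))
        | b <- [:: false; true]]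
  | exec_sample a e s :
      0 < reval s e ->
      exec S (Sample a e) s
        [seq (law S (reval s e) P,
              ((sample_time S (reval s e) + n ^ 2).+1, write_partition s a P))
        | P <- enum {: {set {set 'I_n}}} & 0 < law S (reval s e) P]
  | exec_seq c1 c2 s D F :
      exec S c1 s D ->
      (forall o, List.In o D -> exec S c2 o.2.2 (F o)) ->
      exec S (Seq c1 c2) s (chain D F)
  | exec_if b c1 c2 s D :
      exec S (if beval s b then c1 else c2) s D ->
      exec S (If b c1 c2) s (ticks 1 D)
  | exec_while_end b c s :
      ~~ beval s b ->
      exec S (While b c) s [:: (1, (1%N, s))]
  | exec_while_step b c s D :
      beval s b ->
      exec S (Seq c (While b c)) s D ->
      exec S (While b c) s (ticks 1 D).

Definition expectation_of (R : realType) (D : outcomes R) (F : store R -> R) : R :=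
  \sum_(o <- D) o.1 * F o.2.2.

Definition poly_bounded (t : nat -> nat) : Prop :=
  exists k : nat, forall m : nat, (t m <= k * m ^ k + k)%N.

(* Natural arrays 0, 1, 2 hold the number of vertices, the adjacency matrix and
   the indicator of the terminals; real array 0 holds the edge lengths. *)
Definition input (R : realType) (n : nat) (G : wgraph R 'I_n)
    (K : {set 'I_n}) : store R :=
  Store
    (fun a i j =>
       if a == 0%N then (if (i == 0%N) && (j == 0%N) then n else 0%N)
       else if a == 1%N then
         nat_of_bool [exists u : 'I_n, exists v : 'I_n,
           [&& u == i :> nat, v == j :> nat & edge G u v]]
       else if a == 2%N then
         nat_of_bool ((j == 0%N) && [exists u in K, u == i :> nat])
       else 0%N)
    (fun a i j =>
       if a == 0%N then
         if insub i is Some u then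
           if insub j is Some v then
             if edge G u v then len G u v else 0
           else 0
         else 0
       else 0).

(* The answer f is read off natural array 3, the value at [u] being stored at
   position (u, 0); an entry that is not a vertex is read as [u] itself. *)
Definition output (R : realType) (n : nat) (s : store R) (u : 'I_n) : 'I_n :=
  insubd u (nmem s 3 u 0).

(* The probabilities produced by a terminating computation do sum to one. *)
Lemma exec_mass (R : realType) (n : nat) (S : sampler R 'I_n) c s D :
  exec S c s D -> expectation_of D (fun=> 1) = 1.
Proof.
rewrite /expectation_of; elim => {c s D}
  [s|a e1 e2 e s|a e1 e2 e s|a e1 e2 s|a e s _|c1 c2 s D F _ IH1 _ IH2
  |b c1 c2 s D _ IH|b c s _|b c s D _ _ IH].
- by rewrite big_seq1 mulr1.
- by rewrite big_seq1 mulr1.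
- by rewrite big_seq1 mulr1.
- by rewrite !big_cons big_nil /= !mulr1 addr0 [RHS](splitr 1) !mul1r.
- rewrite big_map big_filter -[RHS](pmf_sum1 (law S (reval s e))).
  rewrite -big_enum big_mkcond /=; apply: eq_bigr => P _.
  rewrite mulr1; case: ltP => // le0; apply/eqP.
  by rewrite eq_le le0 pmf_ge0.
- rewrite -[RHS]IH1 /chain {IH1}; elim: D IH2 => [|o D IHD] IH2; first by rewrite !big_nil.
  rewrite /= big_cat big_cons /= IHD; last by move=> o' Ho'; apply: IH2; right.
  congr (_ + _); rewrite big_map /=.
  have /(congr1 ( *%R o.1)) <- := IH2 o (or_introl erefl).
  by rewrite mulr_sumr; apply: eq_bigr => o' _; rewrite mulrA.
- by rewrite big_map.
- by rewrite big_seq1 mulr1.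
- by rewrite big_map.
Qed.

(* Main.v *)
Require Import Defs.
From Stdlib Require List.
From mathcomp Require Import all_boot all_order all_algebra.
From mathcomp Require Import boolp reals exp.
From mathcomp Require Import zify ring lra.

(** Terminals are assigned to themselves and the assigned region grows through
    rounds at scales r that at least double, r being raised to the length m of a
    shortest crossing edge (one that joins an unassigned vertex to an assigned
    one) whenever 2 r < m.  A round samples a partition at scale r; every class of
    unassigned vertices connected within a cluster that has an edge inside the
    cluster to the assigned region receives one of the terminals met there.  To
    finish within polynomially many rounds whatever the ratio of the lengths, if
    the end of a fixed shortest crossing edge is still unassigned and n m <= r,
    the region grows once more along the edges of length at most m.  That happens
    with probability at most beta m / r and separates only edges longer than m, so
    it costs an edge no more than the sampling does.  An assigned vertex is within
    4 r of its terminal.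

    For an edge of length l, put x = beta l.  While neither end is assigned, a
    round separates the ends with probability at most 2 x / r and then costs O(r),
    so O(x) per round.  If delta is the distance to the terminals, rounds at scales
    below delta / 4 do nothing, and at scale r the edge stays unassigned with
    probability at most beta delta / r (a shortest path to a terminal has to be
    cut), so O(log beta) rounds count in expectation.  While exactly one end is
    assigned, the other remains unassigned with probability at most x / r, and the
    expected final distance is O(r + x).  These bounds form a potential whose
    expectation no round increases. *)

Set Implicit Arguments.
Unset Strict Implicit.
Unset Printing Implicit Defensive.
Import Order.TTheory GRing.Theory Num.Theory.
Local Open Scope ring_scope.

(** * Deterministic programs with bounded loops *)

(* [DFor x c] runs [c] with the register [x] counting from 0 to n - 1, where n
   is read off natural array 0. *)
Inductive dprog :=
  | DSkip
  | DN of nat & nexp & nexp & nexp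
  | DR of nat & nexp & nexp & rexp
  | DSeq of dprog & dprog
  | DIf of bexp & dprog & dprog
  | DFor of nat & dprog.

Definition reg (x : nat) : nexp := NGet x (NConst 0) (NConst 0).

Fixpoint compile (c : dprog) : cmd :=
  match c with
  | DSkip => Skip
  | DN a e1 e2 e => NSet a e1 e2 e
  | DR a e1 e2 e => RSet a e1 e2 e
  | DSeq c1 c2 => Seq (compile c1) (compile c2)
  | DIf b c1 c2 => If b (compile c1) (compile c2)
  | DFor x c =>
      Seq (NSet x (NConst 0) (NConst 0) (NConst 0))
        (While (NLe (NAdd (reg x) (NConst 1)) (reg 0))
           (Seq (compile c)
              (NSet x (NConst 0) (NConst 0) (NAdd (reg x) (NConst 1)))))
  end.

Section Denotation.
Variables (R : realType) (n : nat).

Fixpoint den (c : dprog) (s : store R) : store R :=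
  match c with
  | DSkip => s
  | DN a e1 e2 e => nset s a (neval s e1) (neval s e2) (neval s e)
  | DR a e1 e2 e => rset s a (neval s e1) (neval s e2) (reval s e)
  | DSeq c1 c2 => den c2 (den c1 s)
  | DIf b c1 c2 => if beval s b then den c1 s else den c2 s
  | DFor x c =>
      foldl (fun s k => nset (den c s) x 0 0 k.+1) (nset s x 0 0 0) (iota 0 n)
  end.

Fixpoint nwrites (c : dprog) : seq nat :=
  match c with
  | DSkip | DR _ _ _ _ => [::]
  | DN a _ _ _ => [:: a]
  | DSeq c1 c2 | DIf _ c1 c2 => nwrites c1 ++ nwrites c2
  | DFor x c => x :: nwrites c
  end.

Fixpoint rwrites (c : dprog) : seq nat :=
  match c with
  | DSkip | DN _ _ _ _ => [::]
  | DR a _ _ _ => [:: a]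
  | DSeq c1 c2 | DIf _ c1 c2 => rwrites c1 ++ rwrites c2
  | DFor x c => rwrites c
  end.

Fixpoint well_formed (c : dprog) : bool :=
  match c with
  | DSkip | DR _ _ _ _ | DN _ _ _ _ => true
  | DSeq c1 c2 | DIf _ c1 c2 => well_formed c1 && well_formed c2
  | DFor x c =>
      (x \notin nwrites c) && well_formed c
  end.

(** A conditional is charged for both branches, so that the bound does not depend on the store. The
    final 2 of a loop pays for the initialisation and the failing test. *)
Fixpoint cost (c : dprog) : nat :=
  match c with
  | DSkip | DR _ _ _ _ | DN _ _ _ _ => 1
  | DSeq c1 c2 => cost c1 + cost c2
  | DIf _ c1 c2 => (cost c1 + cost c2).+1
  | DFor x c => (n * (cost c + 2)).+2
  end.

Lemma den_nframe c s a i j :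
  a \notin nwrites c -> nmem (den c s) a i j = nmem s a i j.
Proof.
elim: c s => //= [b e1 e2 e|c1 IH1 c2 IH2|b c1 IH1 c2 IH2|x c IH] s.
- by rewrite inE /upd => /negPf ->.
- by rewrite mem_cat negb_or => /andP[h1 h2]; rewrite IH2 ?IH1.
- by rewrite mem_cat negb_or => /andP[h1 h2]; case: ifP => _; rewrite ?IH2 ?IH1.
- rewrite inE negb_or => /andP[/negPf ax ac].
  have -> : nmem s a i j = nmem (nset s x 0 0 0) a i j by rewrite /= /upd ax.
  elim: (iota 0 n) (nset s x 0 0 0) => //= k l IHl s0.
  by rewrite IHl /= /upd ax IH.
Qed.

Lemma den_rframe c s a i j :
  a \notin rwrites c -> rmem (den c s) a i j = rmem s a i j.
Proof.
elim: c s => //= [b e1 e2 e|c1 IH1 c2 IH2|b c1 IH1 c2 IH2|x c IH] s.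
- by rewrite inE /upd => /negPf ->.
- by rewrite mem_cat negb_or => /andP[h1 h2]; rewrite IH2 ?IH1.
- by rewrite mem_cat negb_or => /andP[h1 h2]; case: ifP => _; rewrite ?IH2 ?IH1.
- move=> ac; have -> : rmem s a i j = rmem (nset s x 0 0 0) a i j by [].
  elim: (iota 0 n) (nset s x 0 0 0) => //= k l IHl s0.
  by rewrite IHl /= IH.
Qed.

Lemma den_for (I : nat -> store R -> Prop) x c s :
  x \notin nwrites c ->
  I 0%N (nset s x 0 0 0) ->
  (forall k s', (k < n)%N -> nmem s' x 0 0 = k -> I k s' ->
     I k.+1 (nset (den c s') x 0 0 k.+1)) ->
  I n (den (DFor x c) s).
Proof.
move=> xc I0 IS /=.
suff H l k s' : (k + l = n)%N -> I k s' -> nmem s' x 0 0 = k ->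
    I n (foldl (fun s k => nset (den c s) x 0 0 k.+1) s' (iota k l)).
  by apply: (H n 0%N) => //=; rewrite /upd !eqxx.
elim: l k s' => [|l IH] k s' kl Ik s'x /=; first by rewrite -kl addn0.
apply: IH; [lia|by apply: IS => //; lia|by rewrite /= /upd !eqxx].
Qed.

(** A compiled program draws nothing, so its law is one outcome of mass 1. Array 0 must survive
    because the loop test rereads [n] there, whereas [den] iterates over a fixed [iota 0 n]. *)
Lemma exec_den (S : sampler R 'I_n) c s :
  well_formed c -> 0%N \notin nwrites c -> nmem s 0 0 0 = n ->
  exists2 t, (t <= cost c)%N & exec S (compile c) s [:: (1, (t, den c s))].
Proof.
have step1 c1 c2 s1 s2 s3 t1 t2 : exec S c1 s1 [:: (1, (t1, s2))] ->
    exec S c2 s2 [:: (1, (t2, s3))] ->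
    exec S (Seq c1 c2) s1 [:: (1, ((t1 + t2)%N, s3))].
  move=> e1 e2.
  have := exec_seq (F := fun=> [:: (1, (t2, s3))]) e1.
  by rewrite /chain /= mul1r; apply=> o [<-|[]].
elim: c s => /= [|a e1 e2 e|a e1 e2 e|c1 IH1 c2 IH2|b c1 IH1 c2 IH2|x c IH] s.
- by move=> _ _ _; exists 1%N => //; constructor.
- by move=> _ _ _; exists 1%N => //; constructor.
- by move=> _ _ _; exists 1%N => //; constructor.
- move=> /andP[w1 w2]; rewrite mem_cat negb_or => /andP[z1 z2] sn.
  have [t1 le1 e1] := IH1 _ w1 z1 sn.
  have [|t2 le2 e2] := IH2 (den c1 s) w2 z2; first by rewrite den_nframe.
  by exists (t1 + t2)%N; [lia|apply: step1 e1 e2].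
- move=> /andP[w1 w2]; rewrite mem_cat negb_or => /andP[z1 z2] sn.
  have [t1 le1 e1] := IH1 _ w1 z1 sn; have [t2 le2 e2] := IH2 _ w2 z2 sn.
  exists (if beval s b then t1.+1 else t2.+1); first by case: ifP => _; lia.
  have := @exec_if _ _ S b (compile c1) (compile c2) s.
  by case: (beval s b) => H; [exact: (H _ e1)|exact: (H _ e2)].
- move=> /andP[xc wc]; rewrite inE negb_or => /andP[x0 zc] sn.
  set W := While _ _.
  suff H l k s' : (k + l = n)%N -> nmem s' 0 0 0 = n -> nmem s' x 0 0 = k ->
      exists2 t, (t <= (l * (cost c + 2)).+1)%N & exec S W s'
        [:: (1, (t, foldl (fun s k => nset (den c s) x 0 0 k.+1) s' (iota k l)))].
    have [|||t le e] := H n 0%N (nset s x 0 0 0) => //=.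
    + by rewrite /upd (negPf x0).
    + by rewrite /upd eqxx.
    exists (1 + t)%N; first lia.
    by apply: step1 e; apply: exec_nset.
  elim: l k s' => [|l IHl] k s' /= kl s'n s'x.
    exists 1%N => //; apply: exec_while_end.
    by rewrite /= s'x s'n -ltnNge; lia.
  have [t1 le1 e1] := IH s' wc zc s'n.
  have E : nmem (den c s') x 0 0 = k by rewrite den_nframe.
  have [|||t le e] := IHl k.+1 (nset (den c s') x 0 0 k.+1).
  + by rewrite addSnnS.
  + by rewrite /= /upd (negPf x0) den_nframe.
  + by rewrite /= /upd !eqxx.
  exists (1 + ((t1 + 1) + t))%N; first by rewrite mulSn; lia.
  have b1 : beval s' (NLe (NAdd (reg x) (NConst 1)) (reg 0)).
    by rewrite /= s'x s'n; lia.
  have e2 : exec S (NSet x (NConst 0) (NConst 0) (NAdd (reg x) (NConst 1)))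
      (den c s') [:: (1, (1%N, nset (den c s') x 0 0 k.+1))].
    by rewrite -[k.+1]addn1 -E; apply: exec_nset.
  exact: (exec_while_step b1 (step1 _ _ _ _ _ _ _ (step1 _ _ _ _ _ _ _ e1 e2) e)).
Qed.

End Denotation.

(** * Laws of randomized programs *)

Section Spec.
Variables (R : realType) (n : nat) (S : sampler R 'I_n) (I : Type).
Implicit Types (c : cmd) (s : store R) (Q : store R -> Prop).
Implicit Types (phi psi : I -> store R -> R) (b : I -> R).

(** A Hoare triple with expectations: [t] and [Q] hold for every outcome, [phi] is bounded on
    average. The family over [I] lets one law [D] serve all edges at once. *)
Definition spec c s (t : nat) Q phi b :=
  exists D : outcomes R,
  [/\ exec S c s D,
      forall o, List.In o D -> [/\ 0 <= o.1, (o.2.1 <= t)%N & Q o.2.2] &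
      forall i, expectation_of D (phi i) <= b i].

Lemma le_expectation (D : outcomes R) (f g : store R -> R) :
  (forall o, List.In o D -> 0 <= o.1 /\ f o.2.2 <= g o.2.2) ->
  expectation_of D f <= expectation_of D g.
Proof.
rewrite /expectation_of; elim: D => [|o D IH] H; first by rewrite !big_nil.
rewrite !big_cons lerD //; last by apply: IH => o' ?; apply: H; right.
by have [o0 fg] := H o (or_introl erefl); rewrite ler_wpM2l.
Qed.

Lemma spec_den (c : dprog) s Q phi b :
  well_formed c -> 0%N \notin nwrites c -> nmem s 0 0 0 = n ->
  Q (den n c s) -> (forall i, phi i (den n c s) <= b i) ->
  spec (compile c) s (cost n c) Q phi b.
Proof.
move=> wc zc sn q le; have [t le_t e] := exec_den S wc zc sn.
exists [:: (1, (t, den n c s))]; split=> // [o [<-|[]]|i] //=.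
by rewrite /expectation_of big_seq1 /= mul1r.
Qed.

Lemma In_flatten_map (A B : Type) (f : A -> seq B) (l : seq A) y :
  List.In y (flatten (map f l)) -> exists2 x, List.In x l & List.In y (f x).
Proof.
elim: l => //= x l IH H; case: (List.in_app_or _ _ _ H) => [H1|/IH[z]].
  by exists x => //; left.
by exists z => //; right.
Qed.

(** The tower property: [psi] bounds the conditional expectation of [phi] given the store after
    [c1]. *)
Lemma spec_seq c1 c2 s t1 t2 Q1 Q psi phi b :
  spec c1 s t1 Q1 psi b ->
  (forall s', Q1 s' -> spec c2 s' t2 Q phi (psi^~ s')) ->
  spec (Seq c1 c2) s (t1 + t2) Q phi b.
Proof.
move=> [D [eD HD ED]] H.
have /choice[F HF] : forall o, exists D', List.In o D ->
    [/\ exec S c2 o.2.2 D',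
      forall o', List.In o' D' -> [/\ 0 <= o'.1, (o'.2.1 <= t2)%N & Q o'.2.2] &
      forall i, expectation_of D' (phi i) <= psi i o.2.2].
  move=> o; have [oD|noD] := pselect (List.In o D); last by exists [::].
  by have [_ _ /H[D' H']] := HD _ oD; exists D'.
exists (chain D F); split.
- by apply: exec_seq eD _ => o /HF[].
- move=> o /(@In_flatten_map _ _ _ _ o)[o1 o1D].
  move=> /(proj1 (List.in_map_iff _ _ _))[o2 [<- o2F]] /=.
  have [p1 le1 _] := HD _ o1D; have [_ /(_ o2 o2F)[p2 le2 q2] _] := HF _ o1D.
  by split=> //; [exact: mulr_ge0|lia].
- move=> i; apply: le_trans (ED i).
  rewrite /expectation_of /chain; elim: (D) HD HF => [|o D' IH] HD HF.
    by rewrite !big_nil.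
  rewrite /= big_cat big_cons /=; apply: lerD; last first.
    by apply: IH => o' ?; [apply: HD|apply: HF]; right.
  rewrite big_map /=; have [p1 _ _] := HD _ (or_introl erefl).
  have [_ _ /(_ i)] := HF _ (or_introl erefl).
  move=> /(ler_wpM2l p1); apply: le_trans; rewrite /expectation_of mulr_sumr.
  by apply: ler_sum => o' _; rewrite mulrA.
Qed.

Lemma spec_if e c1 c2 s t Q phi b :
  spec (if beval s e then c1 else c2) s t Q phi b ->
  spec (If e c1 c2) s t.+1 Q phi b.
Proof.
move=> [D [eD HD ED]]; exists (ticks 1 D); split.
- exact: exec_if.
- by move=> o /(proj1 (List.in_map_iff _ _ _))[o1 [<- /HD[]]] /= *; split.
- by move=> i; apply: le_trans (ED i); rewrite /expectation_of big_map.
Qed.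

Lemma spec_sample a e s Q phi b :
  0 < reval s e ->
  (forall P, 0 < law S (reval s e) P -> Q (write_partition s a P)) ->
  (forall i, \sum_P law S (reval s e) P * phi i (write_partition s a P) <= b i) ->
  spec (Sample a e) s (sample_time S (reval s e) + n ^ 2).+1 Q phi b.
Proof.
move=> e0 q le; exists [seq (law S (reval s e) P,
   ((sample_time S (reval s e) + n ^ 2).+1, write_partition s a P))
  | P <- enum {: {set {set 'I_n}}} & 0 < law S (reval s e) P]; split.
- exact: exec_sample.
- move=> o /(proj1 (List.in_map_iff _ _ _))[P [<-]].
  set l := [seq _ <- _ | _] => Pl; have: P \in l.
    by elim: l Pl => //= P' l IH [->|/IH h]; rewrite inE ?eqxx ?h ?orbT.
  by rewrite mem_filter => /andP[P0 _] /=; split; rewrite ?ltW //; apply: q.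
- move=> i; apply: le_trans (le i); rewrite /expectation_of big_map big_filter.
  rewrite -big_enum big_mkcond /=; apply: ler_sum => P _.
  case: ltP => // le0; have := pmf_ge0 (law S (reval s e)) P => ge0.
  by have -> : law S (reval s e) P = 0 by [lra]; rewrite mul0r.
Qed.

(** [phi] is a supermartingale along the loop, and the measure [N] drops on every outcome, so all
    runs stop. *)
Lemma spec_while e c t (Inv : nat -> store R -> Prop) phi :
  (forall N s, Inv N s -> beval s e ->
     spec c s t (fun s' => exists2 N', (N' < N)%N & Inv N' s') phi (phi^~ s)) ->
  forall N s, Inv N s ->
  spec (While e c) s (N * t.+2).+1
    (fun s' => ~~ beval s' e /\ exists N', Inv N' s') phi (phi^~ s).
Proof.
move=> H N; elim/ltn_ind: N => N IH s INs.
have [be|nbe] := boolP (beval s e); last first.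
  exists [:: (1, (1%N, s))]; split.
  - exact: exec_while_end.
  - by move=> o [<-|[]] //; split=> //=; split=> //; exists N.
  - by move=> i; rewrite /expectation_of big_seq1 mul1r.
(* The outcomes of the body have total mass 1, so one exists, and its measure is below [N]. *)
have N0 : (0 < N)%N.
  have [D [eD HD _]] := H _ _ INs be.
  have := exec_mass eD; rewrite /expectation_of.
  case: D eD HD => [|o D] _ HD; first by rewrite big_nil => /eqP; rewrite eq_sym oner_eq0.
  by have [_ _ [N' lt _]] := HD _ (or_introl erefl); move: lt; case: (N).
have [|D [eD HD ED]] := spec_seq (c2 := While e c) (t2 := (N.-1 * t.+2).+1)
    (Q := fun s' => ~~ beval s' e /\ exists N', Inv N' s') (phi := phi)
    (H _ _ INs be).
  move=> s' [N' lt INs']; have [D [eD HD ED]] := IH _ lt _ INs'.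
  exists D; split=> // o /HD[? le ?]; split=> //; apply: leq_trans le _.
  by rewrite ltnS leq_mul2r; lia.
exists (ticks 1 D); split.
- exact: exec_while_step.
- move=> o /(proj1 (List.in_map_iff _ _ _))[o1 [<- /HD[? le ?]]] /=; split=> //.
  by case: (N) N0 le => // N'; rewrite /= mulSn; lia.
- by move=> i; apply: le_trans (ED i); rewrite /expectation_of big_map.
Qed.

Lemma spec_weaken c s t t' Q Q' phi b :
  spec c s t Q phi b -> (t <= t')%N -> (forall s', Q s' -> Q' s') ->
  spec c s t' Q' phi b.
Proof.
move=> [D [eD HD ED]] le QQ; exists D; split=> // o /HD[? le1 ?].
by split=> //; [apply: leq_trans le|apply: QQ].
Qed.

End Spec.

(** * The shortest-path distance *)

Section Distance.
Variables (R : realType) (T : finType) (G : wgraph R T).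
Hypothesis len_ge0 : forall u v, edge G u v -> 0 <= len G u v.

Lemma walk_len_ge0 x p : path (edge G) x p -> 0 <= walk_len (len G) x p.
Proof.
elim: p x => //= y p IH x /andP[xy yp].
by rewrite addr_ge0 ?len_ge0 ?IH.
Qed.

Lemma dist_le_walk x p :
  path (edge G) x p -> dist G x (last x p) <= walk_len (len G) x p.
Proof.
move=> xp; apply: ge_inf; last by exists p.
by exists 0 => _ [q [xq _ ->]]; apply: walk_len_ge0.
Qed.

Lemma le_dist x y (b : R) : connect (edge G) x y ->
  (forall p, path (edge G) x p -> last x p = y -> b <= walk_len (len G) x p) ->
  b <= dist G x y.
Proof.
move=> /connectP[p xp py] H; apply: lb_le_inf.
  by exists (walk_len (len G) x p), p.
by move=> _ [q [xq qy ->]]; apply: H.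
Qed.

Lemma dist_le_edge x y : edge G x y -> dist G x y <= len G x y.
Proof.
by move=> xy; have := @dist_le_walk x [:: y]; rewrite /= xy addr0; apply.
Qed.

Lemma walk_len_cat x p q :
  walk_len (len G) x (p ++ q) = walk_len (len G) x p + walk_len (len G) (last x p) q.
Proof. by elim: p x => [|y p IH] x /=; rewrite ?add0r // IH addrA. Qed.

Lemma walk_len_le (m : R) x p :
  path [rel a b | edge G a b && (len G a b <= m)] x p ->
  walk_len (len G) x p <= (size p)%:R * m.
Proof.
elim: p x => [|y p IH] x /=; first by rewrite mul0r.
move=> /andP[/andP[_ le] /IH H]; rewrite mulrSr mulrDl mul1r addrC.
exact: lerD.
Qed.

Hypothesis conn : connected_graph (edge G).

Lemma dist_ge0 x y : 0 <= dist G x y.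
Proof. by apply: le_dist => // p xp _; apply: walk_len_ge0. Qed.

Lemma distxx x : dist G x x = 0.
Proof.
by apply/eqP; rewrite eq_le dist_ge0 andbT; apply: (@dist_le_walk x [::]).
Qed.

Lemma dist_triangle y x z : dist G x z <= dist G x y + dist G y z.
Proof.
rewrite -lerBlDr; apply: le_dist => // p xp py.
rewrite lerBlDr -lerBlDl; apply: le_dist => // q yq qz.
rewrite lerBlDl.
have := @dist_le_walk x (p ++ q).
by rewrite cat_path xp py yq last_cat py qz walk_len_cat py; apply.
Qed.

(* A shortest walk may be taken to be simple, hence to have fewer than #|T|
   edges. *)
Lemma dist_le_connect (m : R) x y : 0 <= m ->
  connect [rel a b | edge G a b && (len G a b <= m)] x y ->
  dist G x y <= #|T|%:R * m.
Proof.
move=> m0 /connectP[p xp ->]; case: (shortenP xp) => q xq uq _.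
apply: le_trans (dist_le_walk _) _.
  by apply: sub_path xq => a b /andP[].
apply: le_trans (walk_len_le xq) _; apply: ler_wpM2r => //.
rewrite ler_nat; apply: ltnW.
by have := max_card (mem (x :: q)); rewrite (card_uniqP uq).
Qed.

Hypothesis sym : symmetric (edge G).
Hypothesis lsym : forall u v, edge G u v -> len G u v = len G v u.

Lemma dist_sym x y : dist G x y = dist G y x.
Proof.
suff le a b : dist G a b <= dist G b a by apply/eqP; rewrite eq_le !le.
apply: le_dist => // p; elim: p b => [|c p IH] b /=.
  by move=> _ ->; rewrite distxx.
move=> /andP[bc cp] ca; apply: le_trans (dist_triangle c _ _) _.
rewrite addrC lerD //; last exact: IH.
by rewrite lsym // dist_le_edge // sym.
Qed.

End Distance.

(** * Stretch of an extension: from edges to distances *)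

Section Extension.
Variables (R : realType) (T : finType) (G : wgraph R T).
Hypothesis len_ge0 : forall u v, edge G u v -> 0 <= len G u v.
Hypothesis conn : connected_graph (edge G).

Lemma dist_ext_le_walk (f : T -> T) u p : path (edge G) u p ->
  dist (ext_graph G f) (f u) (f (last u p))
    <= walk_len (fun a b => dist G (f a) (f b)) u p.
Proof.
have len0 a b : edge (ext_graph G f) a b -> 0 <= len (ext_graph G f) a b.
  by move=> _; apply: dist_ge0.
move=> up; have := @dist_le_walk _ _ (ext_graph G f) len0 (f u) (map f p).
rewrite last_map; have -> : walk_len (len (ext_graph G f)) (f u) (map f p) =
    walk_len (fun a b => dist G (f a) (f b)) u p.
  by elim: (p) u {up} => //= v q IH w; rewrite IH.
apply; elim: p u up => //= v p IH u /andP[uv vp]; rewrite IH // andbT.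
by apply/existsP; exists u; apply/existsP; exists v; rewrite uv !eqxx.
Qed.

(* The bound passes from edges to walks by additivity, and to distances by taking
   the infimum over walks. *)
Lemma ext_stretch (D : outcomes R) (f : store R -> T -> T) (c : R) :
  0 < c ->
  (forall o, List.In o D -> 0 <= o.1) ->
  (forall u v, edge G u v ->
     expectation_of D (fun s => dist G (f s u) (f s v)) <= c * len G u v) ->
  forall u v, expectation_of D (fun s => dist (ext_graph G (f s)) (f s u) (f s v))
    <= c * dist G u v.
Proof.
move=> c0 D0 H u v; rewrite mulrC -ler_pdivrMr //; apply: le_dist => // p up <-.
rewrite ler_pdivrMr // mulrC.
apply: le_trans (_ : expectation_of D
   (fun s => walk_len (fun a b => dist G (f s a) (f s b)) u p) <= _).
  by apply: le_expectation => o /D0; split => //; apply: dist_ext_le_walk.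
elim: p u up => [|w p IH] u /=.
  by rewrite /expectation_of mulr0 big1 // => o _; rewrite mulr0.
move=> /andP[uw wp]; rewrite mulrDr.
apply: le_trans (lerD (H _ _ uw) (IH _ wp)).
by rewrite /expectation_of -big_split; apply: ler_sum => o _; rewrite mulrDr.
Qed.

End Extension.

(** * Growing the assigned region along a relation *)

Lemma connect_restrict (T : finType) (e e' : rel T) (P : pred T) u v :
  (forall x y, P x -> e x y -> e' x y /\ P y) ->
  P u -> connect e u v -> connect e' u v.
Proof.
move=> H Pu /connectP[p]; elim: p u Pu => [|w p IH] u Pu /=.
  by move=> _ ->; exact: connect0.
move=> /andP[uw wp] vl; have [e'uw Pw] := H _ _ Pu uw.
by apply: connect_trans (connect1 e'uw) _; apply: IH.
Qed.

Section Merge.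
Variables (T : finType) (e : rel T).
Hypothesis esym : symmetric e.
Implicit Types (M : rel T) (A : T -> nat) (f : T -> nat).

Definition steps M : rel T := [rel u v | e u v && M u v].

(* A vertex [v] is assigned when [A v != 0]; the labels [f] stand for terminals
   on assigned vertices and for classes to be assigned together elsewhere. *)
Definition mono M A f : rel T :=
  [rel u v | [&& e u v, M u v, A u == A v & f u == f v]].

(** Unassigned vertices with equal labels form a class. One merge serves twice: with [b] unassigned
    it unites two classes, with [b] assigned it gives the class of [a] the terminal of [b]. *)
Definition in_class A f a v := (A v == 0%N) && (f v == f a).
Definition merge_asg A f a b v := if in_class A f a v then A b else A v.
Definition merge_lab A f a b v := if in_class A f a v then f b else f v.

(* [code] sends a vertex to its number. *)
Variables (K : {set T}) (code : T -> nat).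

(** The walk keeps both [A] and [f] constant, so it stays among assigned vertices with one terminal;
    this yields connected fibers at the end. *)
Definition rooted A f := forall v, A v != 0%N ->
  exists t, [/\ t \in K, f v = code t & connect (mono (fun _ _ => true) A f) v t].

(** Each new label is traced by an [M]-walk to a vertex assigned at the start, which later bounds
    distances. *)
Record grown M A0 f0 A f : Prop := Grown {
  grown_old : forall v, A0 v != 0%N -> A v = A0 v /\ f v = f0 v;
  grown_new : forall v, A0 v = 0%N -> A v != 0%N ->
    exists w, [/\ A0 w != 0%N, f v = f0 w & connect (steps M) v w];
  grown_class : forall u v, A u = 0%N -> A v = 0%N -> f u = f v ->
    connect (mono M A f) u v;
  grown_rooted : rooted A f }.

Lemma mono_merge M A f a b u v :
  mono M A f u v -> mono M (merge_asg A f a b) (merge_lab A f a b) u v.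
Proof.
move=> /and4P[uv Muv /eqP EA /eqP Ef]; apply/and4P; split=> //.
  by rewrite /merge_asg /in_class EA Ef.
by rewrite /merge_lab /in_class EA Ef.
Qed.

Lemma mono_steps M A f u v : connect (mono M A f) u v -> connect (steps M) u v.
Proof.
by apply: connect_sub => x y /and4P[xy Mxy _ _]; apply: connect1; rewrite /steps /= xy.
Qed.

Lemma mono_true M A f u v :
  connect (mono M A f) u v -> connect (mono (fun _ _ => true) A f) u v.
Proof.
apply: connect_sub => x y /and4P[xy Mxy EA Ef].
by apply: connect1; rewrite /mono /= xy EA Ef.
Qed.

(** Every vertex of the class of [a] reaches [a] inside the class, hence [b] by one more edge; edges
    monochromatic before remain so. *)
Lemma grown_merge M A0 f0 A f a b : symmetric M ->
  grown M A0 f0 A f -> A a = 0%N -> e a b -> M a b ->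
  grown M A0 f0 (merge_asg A f a b) (merge_lab A f a b).
Proof.
move=> Msym [H1 H2 H3 H4] Aa eab Mab.
set A' := merge_asg A f a b; set f' := merge_lab A f a b.
have sub M' u v : connect (mono M' A f) u v -> connect (mono M' A' f') u v.
  by apply: connect_sub => x y h; apply: connect1; apply: mono_merge.
have A'b : A' b = A b by rewrite /A' /merge_asg; case: ifP.
have f'b : f' b = f b by rewrite /f' /merge_lab; case: ifP.
have ab : mono M A' f' a b.
  rewrite /mono /= eab Mab A'b f'b /A' /f' /merge_asg /merge_lab /in_class.
  by rewrite Aa !eqxx.
have cls v : in_class A f a v -> connect (mono M A' f') v b.
  move=> /andP[/eqP Av /eqP fv]; apply: connect_trans (connect1 ab).
  by apply: sub; apply: H3; rewrite ?Av.
have msym : connect_sym (mono M A' f').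
  apply: sym_connect_sym => z w.
  by rewrite /mono /= esym Msym ![_ == A' z]eq_sym ![_ == f' z]eq_sym.
have cls3 u v : A' u = 0%N -> A' v = 0%N -> f' u = f' v ->
    in_class A f a u -> connect (mono M A' f') u v.
  move=> A'u A'v Ef uX; apply: connect_trans (cls _ uX) _.
  have [vX|vX] := boolP (in_class A f a v); first by rewrite msym; apply: cls.
  apply: sub; apply: H3.
  - by rewrite -A'u /A' /merge_asg uX.
  - by rewrite -A'v /A' /merge_asg (negPf vX).
  - by move: Ef; rewrite /f' /merge_lab uX (negPf vX).
split.
- move=> v A0v; have [Av fv] := H1 _ A0v.
  by rewrite /A' /f' /merge_asg /merge_lab /in_class Av (negPf A0v).
- move=> v A0v; rewrite /A' /f' /merge_asg /merge_lab.
  case: ifP => [/andP[/eqP Av /eqP fv] Ab|_]; last exact: H2.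
  have vb : connect (steps M) v b.
    apply: (connect_trans (y := a)); last by apply: connect1; rewrite /steps /= eab.
    by apply: mono_steps; apply: H3; rewrite ?Av.
  (* If [b] was itself assigned during this growth, its source also serves for [v]. *)
  have [A0b|A0b] := eqVneq (A0 b) 0%N.
    by have [w [h1 h2 h3]] := H2 _ A0b Ab; exists w; split=> //; apply: connect_trans h3.
  by exists b; have [_ ->] := H1 _ A0b.
- move=> u v A'u A'v Ef.
  have [uX|uX] := boolP (in_class A f a u); first exact: cls3.
  have [vX|vX] := boolP (in_class A f a v); first by rewrite msym; apply: cls3.
  apply: sub; apply: H3; move: A'u A'v Ef;
    by rewrite /A' /f' /merge_asg /merge_lab (negPf uX) (negPf vX).
- move=> v; have [vX|vX] := boolP (in_class A f a v).
    rewrite /A' /merge_asg vX => /H4[t [tK fb bt]]; exists t.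
    split=> //; first by rewrite /f' /merge_lab vX.
    exact: connect_trans (mono_true (cls _ vX)) (sub _ _ _ bt).
  rewrite /A' /merge_asg (negPf vX) => /H4[t [tK fb bt]]; exists t.
  by split=> //; [rewrite /f' /merge_lab (negPf vX)|apply: sub].
Qed.

(** Unassigned vertices restart as singleton classes because [code] is injective; the walks behind
    [rooted] avoid them. *)
Lemma grown_init M A f f' : injective code -> rooted A f ->
  (forall v, f' v = if A v == 0%N then code v else f v) -> grown M A f A f'.
Proof.
move=> inj rt f'E; split.
- by move=> v Av; rewrite f'E (negPf Av).
- by move=> v ->.
- by move=> u v Au Av; rewrite !f'E Au Av /= => /inj ->; apply: connect0.
- move=> v Av; have [t [tK fv vt]] := rt _ Av; exists t.
  split=> //; first by rewrite f'E (negPf Av).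
  apply: (connect_restrict (P := fun w => A w != 0%N)) vt => // x y Ax.
  move=> /and4P[xy _ /eqP EA /eqP Ef]; rewrite /mono /= xy !f'E -EA eqxx (negPf Ax) Ef.
  by rewrite eqxx.
Qed.

Lemma merge_asg_id A f a b v : A b = 0%N -> merge_asg A f a b v = A v.
Proof. by move=> Ab; rewrite /merge_asg Ab; case: ifP => // /andP[/eqP ->]. Qed.

Lemma merge_same A f a b u v : A u = A v -> f u = f v ->
  merge_asg A f a b u = merge_asg A f a b v /\
  merge_lab A f a b u = merge_lab A f a b v.
Proof. by move=> EA Ef; rewrite /merge_asg /merge_lab /in_class EA Ef. Qed.

Lemma merge_assigned A f a b u : A u != 0%N ->
  merge_asg A f a b u = A u.
Proof. by move=> Au; rewrite /merge_asg /in_class (negPf Au). Qed.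

Lemma merge_fst A f a b : A a = 0%N ->
  merge_asg A f a b a = A b /\ merge_lab A f a b a = f b.
Proof. by move=> Aa; rewrite /merge_asg /merge_lab /in_class Aa !eqxx. Qed.

Lemma merge_snd A f a b : merge_asg A f a b b = A b /\ merge_lab A f a b b = f b.
Proof. by rewrite /merge_asg /merge_lab; case: ifP. Qed.

End Merge.

(** * The growing step as a program *)

(* Natural array 2, initially the indicator of the terminals, is updated in
   place to indicate the assigned vertices; array 3 holds the labels. *)
Definition rasg (x : nat) : nexp := NGet 2 (reg x) (NConst 0).
Definition rlab (x : nat) : nexp := NGet 3 (reg x) (NConst 0).
Definition set_reg (x : nat) (e : nexp) : dprog := DN x (NConst 0) (NConst 0) e.

Definition relabel : dprog :=
  DFor 12 (DIf (BAnd (NLe (rasg 12) (NConst 0))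
                  (BAnd (NLe (rlab 12) (reg 13)) (NLe (reg 13) (rlab 12))))
             (DSeq (DN 3 (reg 12) (NConst 0) (reg 14))
                (DN 2 (reg 12) (NConst 0) (reg 15)))
             DSkip).

(** The values are copied into registers first, because [relabel] may overwrite the entries they
    come from. *)
Definition merge : dprog :=
  DSeq (set_reg 13 (rlab 10))
    (DSeq (set_reg 14 (rlab 11)) (DSeq (set_reg 15 (rasg 11)) relabel)).

Definition pass (g : bexp) : dprog :=
  DFor 10 (DFor 11
    (DIf (BAnd (NLe (rasg 10) (NConst 0))
            (BAnd (NLe (NConst 1) (NGet 1 (reg 10) (reg 11))) g))
       merge DSkip)).

Definition reset : dprog :=
  DFor 12 (DIf (NLe (rasg 12) (NConst 0)) (DN 3 (reg 12) (NConst 0) (reg 12))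
             DSkip).

(* Merging the unassigned classes first makes every class receive a single
   terminal in the second pass. *)
Definition grow (g : bexp) : dprog :=
  DSeq reset (DSeq (pass (BAnd (NLe (rasg 11) (NConst 0)) g)) (pass g)).

(** * Correctness of the growing step *)

Section Grow.
Variables (R : realType) (n : nat).
Implicit Types (s : store R) (g : bexp).

Definition asg s (v : 'I_n) : nat := nmem s 2 v 0.
Definition lab s (v : 'I_n) : nat := nmem s 3 v 0.

(** Rule for two nested loops: [Q a b] is established by the iteration at [a], [b] and kept by all
    later ones. *)
Lemma den_pairs (Inv : store R -> Prop) (Q : 'I_n -> 'I_n -> store R -> Prop)
    xa xb c s :
  xa \notin xb :: nwrites c -> xb \notin nwrites c ->
  (forall s x k, x \in [:: xa; xb] -> Inv s -> Inv (nset s x 0 0 k)) ->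
  (forall a b s x k, x \in [:: xa; xb] -> Q a b s -> Q a b (nset s x 0 0 k)) ->
  (forall (a b : 'I_n) s, nmem s xa 0 0 = a -> nmem s xb 0 0 = b -> Inv s ->
     [/\ Inv (den n c s), Q a b (den n c s) &
         forall a' b', Q a' b' s -> Q a' b' (den n c s)]) ->
  Inv s ->
  let s' := den n (DFor xa (DFor xb c)) s in
  Inv s' /\ forall a b, Q a b s'.
Proof.
move=> nxa nxb setI setQ step Is.
have [xain xbin] : xa \in [:: xa; xb] /\ xb \in [:: xa; xb].
  by rewrite !inE !eqxx orbT.
pose I1 k s := Inv s /\ forall a b : 'I_n, (a < k)%N -> Q a b s.
suff: I1 n (den n (DFor xa (DFor xb c)) s) by move=> [? H]; split=> // a b; apply: H.
apply: den_for => //; first by split; [apply: setI|].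
move=> k s1 kn s1a [Is1 Qs1].
pose I2 l s := [/\ nmem s xa 0 0 = k, Inv s,
  forall a b : 'I_n, (a < k)%N -> Q a b s &
  forall a b : 'I_n, a = k :> nat -> (b < l)%N -> Q a b s].
suff [_ Is2 H1 H2] : I2 n (den n (DFor xb c) s1).
  split; first exact: setI.
  move=> a b; rewrite ltnS leq_eqVlt => /orP[/eqP ak|ak]; apply: setQ => //.
    exact: H2.
  exact: H1.
have nab : (xa == xb) = false by apply/negbTE; move: nxa; rewrite inE negb_or => /andP[].
have nac : xa \notin nwrites c by move: nxa; rewrite inE negb_or => /andP[].
apply: den_for => //.
  split=> //; [by rewrite /= /upd nab|exact: setI|by move=> *; apply: setQ => //; apply: Qs1].
move=> l s2 ln s2b [s2a Is2 Q1 Q2].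
have [Is3 Q3 Q4] := step (Ordinal kn) (Ordinal ln) s2 s2a s2b Is2.
split.
- by rewrite /= /upd nab den_nframe.
- exact: setI.
- by move=> a b ak; apply: setQ => //; apply: Q4; apply: Q1.
- move=> a b ak; rewrite ltnS leq_eqVlt => /orP[/eqP bl|bl]; apply: setQ => //.
    have -> : a = Ordinal kn by apply: val_inj.
    by have -> : b = Ordinal ln by apply: val_inj.
  by apply: Q4; apply: Q2.
Qed.

Definition scratch : seq nat := [:: 2; 3; 10; 11; 12; 13; 14; 15]%N.

Definition agrees s0 s :=
  (forall a i j, a \notin scratch -> nmem s a i j = nmem s0 a i j) /\
  (forall a i j, rmem s a i j = rmem s0 a i j).

Lemma agrees_den s0 s c : agrees s0 s ->
  all (mem scratch) (nwrites c) -> rwrites c = [::] -> agrees s0 (den n c s).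
Proof.
move=> [H1 H2] /allP wc rc; split=> a i j.
  by move=> na; rewrite den_nframe ?H1 //; apply: contra na => /wc.
by rewrite den_rframe ?H2 // rc.
Qed.

Lemma agrees_nset s0 s x i j k : agrees s0 s -> x \in scratch ->
  agrees s0 (nset s x i j k).
Proof.
move=> [h1 h2] xs; split=> // a i' j' na /=; rewrite /upd.
by case: eqP => [ax|_]; [rewrite ax xs in na|exact: h1].
Qed.

Lemma den_if g c1 c2 s :
  den n (DIf g c1 c2) s = if beval s g then den n c1 s else den n c2 s.
Proof. by []. Qed.

Lemma den_merge s (a b : 'I_n) :
  nmem s 10 0 0 = a -> nmem s 11 0 0 = b -> forall v,
  asg (den n merge s) v = merge_asg (asg s) (lab s) a b v /\
  lab (den n merge s) v = merge_lab (asg s) (lab s) a b v.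
Proof.
move=> sa sb.
pose I k s' := [/\ nmem s' 13 0 0 = lab s a, nmem s' 14 0 0 = lab s b,
  nmem s' 15 0 0 = asg s b & forall v : 'I_n, if (v < k)%N
    then asg s' v = merge_asg (asg s) (lab s) a b v /\
         lab s' v = merge_lab (asg s) (lab s) a b v
    else asg s' v = asg s v /\ lab s' v = lab s v].
suff: I n (den n merge s) by move=> [_ _ _ H] v; have := H v; rewrite ltn_ord.
rewrite (_ : den n merge s = den n relabel (den n (DSeq (set_reg 13 (rlab 10))
  (DSeq (set_reg 14 (rlab 11)) (set_reg 15 (rasg 11)))) s)) //.
apply: (den_for (I := I)) => //.
  by split=> //=; rewrite /= /upd /= ?sa ?sb.
move=> k s' kn s'k [h13 h14 h15 H].
have := H (Ordinal kn); rewrite /= ltnn => -[ka kf].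
have ka' : nmem s' 2 k 0 = asg s (Ordinal kn) by [].
have kf' : nmem s' 3 k 0 = lab s (Ordinal kn) by [].
have E : beval s' (BAnd (NLe (rasg 12) (NConst 0))
      (BAnd (NLe (rlab 12) (reg 13)) (NLe (reg 13) (rlab 12)))) =
    in_class (asg s) (lab s) a (Ordinal kn).
  by rewrite /= s'k h13 ka' kf' /in_class leqn0 -eqn_leq.
move: E => /= E; rewrite /I E.
split.
- by case: ifP.
- by case: ifP.
- by case: ifP.
move=> v; rewrite ltnS leq_eqVlt; case: eqP => [vk|vk] /=.
  have -> : v = Ordinal kn by apply: val_inj.
  rewrite /merge_asg /merge_lab; case: ifP => _ /=; last by [].
  by rewrite /asg /lab /= /upd /= s'k !eqxx /= h14 h15.
have nvk : (v == k :> nat) = false by apply/eqP.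
have := H v; case: ifP => _; case: ifP => _ //;
  by rewrite /asg /lab /= /upd /= s'k nvk.
Qed.

Lemma den_reset s v :
  asg (den n reset s) v = asg s v /\
  lab (den n reset s) v = (if asg s v == 0%N then val v else lab s v).
Proof.
pose I k s' := forall v : 'I_n, asg s' v = asg s v /\
   lab s' v = (if (v < k)%N && (asg s v == 0%N) then val v else lab s v).
suff: I n (den n reset s) by move=> /(_ v); rewrite ltn_ord.
apply: (den_for (I := I)) => // k s' kn s'k H {}v.
have [Ha Hl] := H v; rewrite /= s'k.
have -> : (nmem s' 2 k 0 <= 0)%N = (asg s (Ordinal kn) == 0%N).
  by have [<- _] := H (Ordinal kn); rewrite leqn0.
rewrite ltnS leq_eqVlt; case: (eqVneq (v : nat) k) => [vk|nvk] /=.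
  have <- : v = Ordinal kn by apply: val_inj.
  case: ifP => h0 /=; rewrite /asg /lab /= /upd /= ?vk ?eqxx /= -?vk; split=> //.
  by move: Hl; rewrite h0 andbF.
by case: ifP => _; split; rewrite // /asg /lab /= /upd /= (negPf nvk).
Qed.

Variables (G : wgraph R 'I_n) (K : {set 'I_n}).
Hypothesis sym : symmetric (edge G).

Definition holds_adj s := forall i j : 'I_n, nmem s 1 i j = nat_of_bool (edge G i j).

(** The value may depend only on the two loop registers and on memory preserved by [agrees], so [M]
    stays fixed while the labels change. *)
Definition guards g s0 (M : rel 'I_n) := forall s (a b : 'I_n), agrees s0 s ->
  nmem s 10 0 0 = a -> nmem s 11 0 0 = b -> beval s g = M a b.

Notation code := (@nat_of_ord n).
Notation J M s0 s := (grown (edge G) K code M (asg s0) (lab s0) (asg s) (lab s)).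

Lemma asg_den_merge s (a b : 'I_n) :
  nmem s 10 0 0 = a -> nmem s 11 0 0 = b ->
  asg (den n merge s) = merge_asg (asg s) (lab s) a b /\
  lab (den n merge s) = merge_lab (asg s) (lab s) a b.
Proof. by move=> ha hb; split; apply/funext => v; have [] := den_merge ha hb v. Qed.

Lemma agrees_adj s0 s (a b : 'I_n) : holds_adj s0 -> agrees s0 s ->
  (0 < nmem s 1 a b)%N = edge G a b.
Proof. by move=> H [-> // _]; rewrite H; case: edge. Qed.

Lemma agrees_merge s0 s : agrees s0 s -> agrees s0 (den n merge s).
Proof. by move=> H; apply: agrees_den. Qed.

(** Only unassigned vertices merge here, so [asg] does not change; labels once equal stay equal,
    since a merge treats such vertices alike. *)
Lemma pass_classes g s0 s1 (M : rel 'I_n) :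
  symmetric M -> holds_adj s0 -> guards g s0 M ->
  agrees s0 s1 -> J M s1 s1 ->
  let s2 := den n (pass (BAnd (NLe (rasg 11) (NConst 0)) g)) s1 in
  [/\ agrees s0 s2, J M s1 s2, asg s2 = asg s1 &
      forall a b, asg s1 a = 0%N -> asg s1 b = 0%N -> edge G a b -> M a b ->
        lab s2 a = lab s2 b].
Proof.
move=> Msym adj gM ag0 J0.
pose Inv s := [/\ agrees s0 s, J M s1 s & asg s = asg s1].
pose Q a b s := asg s = asg s1 /\ (asg s1 a = 0%N -> asg s1 b = 0%N ->
  edge G a b -> M a b -> lab s a = lab s b).
suff [[h1 h2 h3] h4] : Inv (den n (pass (BAnd (NLe (rasg 11) (NConst 0)) g)) s1)
    /\ forall a b, Q a b (den n (pass (BAnd (NLe (rasg 11) (NConst 0)) g)) s1).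
  by split=> // a b; have [_] := h4 a b.
apply: (den_pairs (Inv := Inv) (Q := Q)) => //.
- move=> s x k; rewrite !inE => /orP[]/eqP ->; case=> h1 h2 h3;
    by split=> //; apply: agrees_nset.
- by move=> a b s x k; rewrite !inE => /orP[]/eqP ->.
- move=> a b s sa sb [ag Js EA].
  have gs := gM _ _ _ ag sa sb; have ads := agrees_adj a b adj ag.
  rewrite den_if [beval _ _]/= sa sb gs ads.
  rewrite -/(asg s a) -/(asg s b) !leqn0; case: ifPn => [|/negP nc].
    move=> /andP[/eqP a0 /andP[eab /andP[/eqP b0 Mab]]].
    have [mA mL] := asg_den_merge sa sb.
    have mA' : merge_asg (asg s) (lab s) a b = asg s.
      by apply/funext => v; apply: merge_asg_id.
    split.
    + split; [exact: agrees_merge| |by rewrite mA mA'].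
      by rewrite mA mL; apply: grown_merge.
    + split; first by rewrite mA mA'.
      by rewrite mL (merge_fst (lab s) b a0).2 (merge_snd (asg s) (lab s) a b).2.
    + move=> a' b' [_ q]; split; first by rewrite mA mA'.
      move=> a'0 b'0 e' M'; rewrite mL; apply: (merge_same _ _ _ _).2.
        by rewrite EA a'0 b'0.
      exact: q.
  split=> //; split=> // a0 b0 eab Mab; case: nc.
  by rewrite EA a0 b0 eab Mab.
Qed.

(** A merge acts on a whole class, so [M]-adjacent vertices, which share a class after the first
    pass, receive the same terminal. *)
Lemma pass_assign g s0 s1 s2 (M : rel 'I_n) :
  symmetric M -> holds_adj s0 -> guards g s0 M ->
  agrees s0 s2 -> J M s1 s2 -> asg s2 = asg s1 ->
  (forall a b, asg s1 a = 0%N -> asg s1 b = 0%N -> edge G a b -> M a b ->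
     lab s2 a = lab s2 b) ->
  let s3 := den n (pass g) s2 in
  [/\ agrees s0 s3, J M s1 s3,
      forall a b, asg s1 a = 0%N -> asg s1 b = 0%N -> edge G a b -> M a b ->
        asg s3 a = asg s3 b /\ lab s3 a = lab s3 b &
      forall a b, asg s1 b != 0%N -> edge G a b -> M a b -> asg s3 a != 0%N].
Proof.
move=> Msym adj gM ag2 J2 EA same.
pose Inv s := [/\ agrees s0 s, J M s1 s &
  forall a b, asg s1 a = 0%N -> asg s1 b = 0%N -> edge G a b -> M a b ->
        asg s a = asg s b /\ lab s a = lab s b].
pose Q a b s := asg s1 b != 0%N -> edge G a b -> M a b -> asg s a != 0%N.
suff [[h1 h2 h3] h4] : Inv (den n (pass g) s2) /\ forall a b, Q a b (den n (pass g) s2).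
  by split=> // a b; have [_] := h4 a b.
apply: (den_pairs (Inv := Inv) (Q := Q)) => //.
- move=> s x k; rewrite !inE => /orP[]/eqP ->; case=> h1 h2 h3;
    by split=> //; apply: agrees_nset.
- by move=> a b s x k; rewrite !inE => /orP[]/eqP ->.
- move=> a b s sa sb [ag Js sm].
  have gs := gM _ _ _ ag sa sb; have ads := agrees_adj a b adj ag.
  rewrite den_if [beval _ _]/= sa sb gs ads.
  rewrite -/(asg s a) !leqn0; case: ifPn => [|/negP nc].
    move=> /andP[/eqP a0 /andP[eab Mab]].
    have [mA mL] := asg_den_merge sa sb.
    split.
    + split; first exact: agrees_merge.
        by rewrite mA mL; apply: grown_merge.
      move=> a' b' a'0 b'0 e' M'; rewrite mA mL; apply: merge_same.
        by have [] := sm _ _ a'0 b'0 e' M'.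
      by have [] := sm _ _ a'0 b'0 e' M'.
    + move=> b0 _ _; rewrite mA (merge_fst (lab s) b a0).1.
      by have [-> _] := grown_old Js b0.
    + move=> a' b' q b0 e' M'; have A0 := q b0 e' M'.
      by rewrite mA merge_assigned.
  split=> // b0 eab Mab; apply/negP => a0; case: nc.
  by rewrite a0 eab Mab.
- split=> // a b a0 b0 eab Mab; split; last exact: same.
  by rewrite EA a0 b0.
Qed.

Record grow_spec (M : rel 'I_n) s s' : Prop := GrowSpec {
  gs_old : forall v, asg s v != 0%N -> asg s' v = asg s v /\ lab s' v = lab s v;
  gs_new : forall v, asg s v = 0%N -> asg s' v != 0%N ->
    exists w, [/\ asg s w != 0%N, lab s' v = lab s w &
      connect (steps (edge G) M) v w];
  gs_adj : forall a b, asg s b != 0%N -> edge G a b -> M a b -> asg s' a != 0%N;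
  gs_same : forall a b, asg s a = 0%N -> asg s b = 0%N -> edge G a b -> M a b ->
    asg s' a = asg s' b /\ (asg s' a != 0%N -> lab s' a = lab s' b);
  gs_rooted : rooted (edge G) K code (asg s') (lab s') }.

Lemma den_grow g s (M : rel 'I_n) :
  symmetric M -> holds_adj s -> guards g s M ->
  rooted (edge G) K code (asg s) (lab s) ->
  agrees s (den n (grow g) s) /\ grow_spec M s (den n (grow g) s).
Proof.
move=> Msym adj gM rt; rewrite [den _ _ _]/=.
set s1 := den n reset s.
have ag1 : agrees s s1 by apply: agrees_den.
have EA : asg s1 = asg s by apply/funext => v; have [] := den_reset s v.
have EL v : lab s1 v = if asg s v == 0%N then val v else lab s v.
  by have [] := den_reset s v.
have J1 : grown (edge G) K code M (asg s) (lab s) (asg s1) (lab s1).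
  by rewrite EA; apply: grown_init => //; apply: ord_inj.
(* The passes start afresh from the labels left by [reset]; [EL] translates the result back to
   [s]. *)
have J11 : J M s1 s1.
  case: J1 => h1 h2 h3 h4; split=> // v h Nh; by rewrite h in Nh.
have [ag2 J2 EA2 same] := pass_classes Msym adj gM ag1 J11.
have [ag3 J3 same3 adj3] := pass_assign Msym adj gM ag2 J2 EA2 same.
set s3 := den n (pass g) _ in ag3 J3 same3 adj3 *.
rewrite EA in same3 adj3; split=> //.
case: J3; rewrite EA => h1 h2 h3 h4; split=> //.
- move=> v v0; have [-> ->] := h1 _ v0; split=> //.
  by rewrite EL (negPf v0).
- move=> v v0 v3; have [w [w0 -> vw]] := h2 _ v0 v3; exists w; split=> //.
  by rewrite EL (negPf w0).
- by move=> a b a0 b0 e' M'; have [] := same3 _ _ a0 b0 e' M'.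
Qed.

End Grow.

(** * One round of the algorithm *)

Definition rreg (a : nat) : rexp := RGet a (NConst 0) (NConst 0).
Definition set_rreg (a : nat) (e : rexp) : dprog := DR a (NConst 0) (NConst 0) e.

(* A crossing edge joins an unassigned vertex to an assigned one.  Register 16
   tells whether there is one; if so, register 17 holds the unassigned end of a
   shortest one and real register 2 its length. *)
Definition scan : dprog :=
  DSeq (set_reg 16 (NConst 0))
    (DFor 10 (DFor 11
      (DIf (BAnd (NLe (rasg 10) (NConst 0))
           (BAnd (NLe (NConst 1) (rasg 11))
           (BAnd (NLe (NConst 1) (NGet 1 (reg 10) (reg 11)))
              (BNot (BAnd (NLe (NConst 1) (reg 16))
                       (RLe (rreg 2) (RGet 0 (reg 10) (reg 11))))))))
         (DSeq (set_reg 16 (NConst 1))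
            (DSeq (set_reg 17 (reg 10))
               (set_rreg 2 (RGet 0 (reg 10) (reg 11)))))
         DSkip))).

(* Real register 1 holds the current scale. *)
Definition rescale : dprog :=
  DSeq (set_rreg 1 (RAdd (rreg 1) (rreg 1)))
    (DIf (RLe (rreg 1) (rreg 2)) (set_rreg 1 (rreg 2)) DSkip).

(** The product of [n] and the gap by repeated addition, starting from a zero written as a
    difference. *)
Definition times_n : dprog :=
  DSeq (set_rreg 3 (RSub (rreg 2) (rreg 2)))
    (DFor 10 (set_rreg 3 (RAdd (rreg 3) (rreg 2)))).

Definition force : dprog :=
  DSeq times_n
    (DIf (BAnd (NLe (NGet 2 (reg 17) (NConst 0)) (NConst 0))
            (RLe (rreg 3) (rreg 1)))
       (grow (RLe (RGet 0 (reg 10) (reg 11)) (rreg 2))) DSkip).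

Definition tail : dprog := DSeq force scan.

Definition sampled_tail : dprog :=
  DSeq (grow (NLe (NConst 1) (NGet 5 (reg 10) (reg 11)))) tail.

(** * Effect of one round on the assignment *)

Section Round.
Variables (R : realType) (n : nat) (G : wgraph R 'I_n) (K : {set 'I_n}).
Implicit Types (s : store R).
Hypothesis sym : symmetric (edge G).
Hypothesis lsym : forall u v, edge G u v -> len G u v = len G v u.
Hypothesis len_ge0 : forall u v, edge G u v -> 0 <= len G u v.
Hypothesis conn : connected_graph (edge G).

Notation code := (@nat_of_ord n).
Local Notation asg := (@asg R n).
Local Notation lab := (@lab R n).
Notation d := (dist G).

Definition matrix_len (i j : 'I_n) : R := if edge G i j then len G i j else 0.

Definition holds_input s :=
  [/\ nmem s 0 0 0 = n, holds_adj G s &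
      forall i j : 'I_n, rmem s 0 i j = matrix_len i j].

Definition crossing s (i j : 'I_n) := [&& asg s i == 0%N, asg s j != 0%N & edge G i j].

Definition scale s : R := rmem s 1 0 0.
Definition gap s : R := rmem s 2 0 0.

Definition shortest_crossing s (i j : 'I_n) :=
  [/\ crossing s i j, nmem s 17 0 0 = i, gap s = len G i j &
      forall i' j', crossing s i' j' -> gap s <= len G i' j'].

Definition scanned s :=
  if nmem s 16 0 0 == 0%N then forall i j, ~~ crossing s i j
  else exists i j, shortest_crossing s i j.

Lemma holds_input_frame s s' :
  (forall i j, nmem s' 0 i j = nmem s 0 i j) ->
  (forall i j, nmem s' 1 i j = nmem s 1 i j) ->
  (forall i j, rmem s' 0 i j = rmem s 0 i j) ->
  holds_input s -> holds_input s'.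
Proof.
by move=> h0 h1 h2 [H1 H2 H3]; split=> [|i j|i j]; rewrite ?h0 ?h1 ?h2 ?H2 ?H3.
Qed.

Lemma asg_frame c s : 2%N \notin nwrites c -> asg (den n c s) = asg s.
Proof. by move=> h; apply/funext => v; apply: den_nframe. Qed.

Lemma lab_frame c s : 3%N \notin nwrites c -> lab (den n c s) = lab s.
Proof. by move=> h; apply/funext => v; apply: den_nframe. Qed.

Lemma holds_input_den c s :
  0%N \notin nwrites c -> 1%N \notin nwrites c -> 0%N \notin rwrites c ->
  holds_input s -> holds_input (den n c s).
Proof.
by move=> h0 h1 h2; apply: holds_input_frame => i j; rewrite ?den_nframe ?den_rframe.
Qed.

Lemma scanned_scan s : holds_input s -> scanned (den n scan s).
Proof.
move=> inp; rewrite /scan.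
pose Inv s' := holds_input s' /\ (nmem s' 16 0 0 != 0%N -> exists i j : 'I_n,
  [/\ crossing s' i j, nmem s' 17 0 0 = i & gap s' = len G i j]).
pose Q i j s' := crossing s' i j -> nmem s' 16 0 0 != 0%N /\ gap s' <= len G i j.
set c := DFor 10 _; set s1 := den n (set_reg 16 (NConst 0)) s.
have -> : den n (DSeq (set_reg 16 (NConst 0)) c) s = den n c s1 by [].
have [] : Inv (den n c s1) /\ forall i j, Q i j (den n c s1).
  apply: (den_pairs (Inv := Inv) (Q := Q)) => //.
  - by move=> s' x k; rewrite !inE => /orP[]/eqP ->.
  - by move=> a b s' x k; rewrite !inE => /orP[]/eqP ->.
  - move=> a b s' sa sb [[in1 in2 in3] H]; rewrite den_if.
    set g := beval _ _; have gE : g =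
        crossing s' a b && ~~ ((nmem s' 16 0 0 != 0%N) && (gap s' <= len G a b)).
      rewrite /g /= sa sb in2 in3 /matrix_len /crossing leqn0 !lt0n -/(gap s') -/(asg s' a).
      by rewrite -/(asg s' b); case: edge; rewrite /= ?andbF ?andbT ?andbA.
    rewrite gE; case: ifPn => [/andP[cr nle]|nc].
      have cr' : crossing (den n (DSeq (set_reg 16 (NConst 1))
        (DSeq (set_reg 17 (reg 10)) (set_rreg 2 (RGet 0 (reg 10) (reg 11))))) s') a b by [].
      have /and3P[_ _ eab] := cr.
      have gp : gap (den n (DSeq (set_reg 16 (NConst 1))
        (DSeq (set_reg 17 (reg 10)) (set_rreg 2 (RGet 0 (reg 10) (reg 11))))) s') = len G a b.
        by rewrite /gap /= /upd /= sa sb in3 /matrix_len eab.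
      split.
      + split; first by split.
        by move=> _; exists a, b; split=> //; rewrite /= /upd /= sa.
      + by move=> _; split=> //; rewrite gp.
      + move=> a' b' q cr''; have [f0 le] := q cr''; split=> //.
        rewrite gp; move: nle; rewrite f0 /= -ltNge => lt.
        exact: le_trans (ltW lt) le.
    split=> //; move=> cr; move: nc; rewrite cr /= negbK => /andP[-> ->] //.
set s2 := den n c s1; move=> [_ H] HQ; rewrite /scanned.
case: eqP => [f0|/eqP f0].
  by move=> i j; apply/negP => /HQ[]; rewrite f0.
have [i [j [cr bi gp]]] := H f0; exists i, j; split=> //.
by move=> i' j' /HQ[].
Qed.

Lemma den_rescale s :
  let s' := den n rescale s in
  [/\ scale s' = Num.max (scale s + scale s) (gap s), gap s' = gap s,
      nmem s' = nmem s & forall i j, rmem s' 0 i j = rmem s 0 i j].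
Proof.
rewrite /rescale /scale /gap /= {2 3}/upd /=.
case: leP => h /=; rewrite /upd /=; split=> //.
Qed.

Lemma den_times_n s : rmem (den n times_n s) 3 0 0 = n%:R * gap s.
Proof.
pose I k s' := rmem s' 3 0 0 = k%:R * gap s /\ gap s' = gap s.
suff [] : I n (den n times_n s) by [].
rewrite (_ : den n times_n s = den n (DFor 10 (set_rreg 3 (RAdd (rreg 3) (rreg 2))))
  (den n (set_rreg 3 (RSub (rreg 2) (rreg 2))) s)) //.
apply: (den_for (I := I)) => //.
  by split=> //; rewrite mul0r /= /upd /= subrr.
move=> k s' _ _ [h1 h2]; split=> //.
by rewrite /= /upd /= h1 -[rmem s' 2 0 0]/(gap s') h2 mulrSr mulrDl mul1r.
Qed.

Definition short (m : R) : rel 'I_n := [rel a b | matrix_len a b <= m].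

Lemma short_sym m : symmetric (short m).
Proof.
move=> a b; rewrite /short /= /matrix_len sym; case: ifP => // ba.
by rewrite (lsym ba).
Qed.

Lemma grow_spec_ext M s1 s2 s1' s2' :
  asg s1 = asg s1' -> lab s1 = lab s1' -> asg s2 = asg s2' -> lab s2 = lab s2' ->
  grow_spec G K M s1 s2 -> grow_spec G K M s1' s2'.
Proof.
by move=> h1 h2 h3 h4 [*]; split; rewrite -?h1 -?h2 -?h3 -?h4.
Qed.

Lemma den_force s (i : 'I_n) : holds_input s -> nmem s 17 0 0 = i ->
  rooted (edge G) K code (asg s) (lab s) ->
  let s' := den n force s in
  [/\ holds_input s', scale s' = scale s &
      if (asg s i == 0%N) && (n%:R * gap s <= scale s)
      then grow_spec G K (short (gap s)) s s'
      else asg s' = asg s /\ lab s' = lab s].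
Proof.
move=> inp si rt; split.
- exact: holds_input_den.
- by rewrite /scale den_rframe.
rewrite (_ : den n force s = den n (DIf (BAnd (NLe (NGet 2 (reg 17) (NConst 0)) (NConst 0))
            (RLe (rreg 3) (rreg 1)))
       (grow (RLe (RGet 0 (reg 10) (reg 11)) (rreg 2))) DSkip) (den n times_n s)) //.
have EA := asg_frame s (c := times_n) isT; have EL := lab_frame s (c := times_n) isT.
have inp1 : holds_input (den n times_n s) by apply: holds_input_den.
have gE : gap (den n times_n s) = gap s by rewrite /gap den_rframe.
set s1 := den n times_n s in EA EL inp1 gE *; rewrite den_if.
have -> : beval s1 (BAnd (NLe (NGet 2 (reg 17) (NConst 0)) (NConst 0))
            (RLe (rreg 3) (rreg 1))) = (asg s i == 0%N) && (n%:R * gap s <= scale s).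
  rewrite [beval _ _]/= leqn0 den_times_n.
  by rewrite (den_nframe n (c := times_n) s _ _ (a := 17)) // si -/(asg s1 i) EA
    (den_rframe n (c := times_n) s _ _ (a := 1)).
case: ((asg s i == 0%N) && (n%:R * gap s <= scale s)); last by split; [exact: EA|exact: EL].
have [||||_] := @den_grow R n G K sym (RLe (RGet 0 (reg 10) (reg 11)) (rreg 2))
   s1 (short (gap s)).
- exact: short_sym.
- by case: inp1.
- move=> s2 a b [_ ag] h1 h2; rewrite /= h1 h2 !ag.
  by case: inp1 => _ _ ->; rewrite -/(gap s1) gE.
- by rewrite EA EL.
by apply: grow_spec_ext.
Qed.

(** A simple walk has fewer than [n] edges, which is why [force] compares [n m] with the scale. *)
Lemma short_dist m v w : 0 <= m ->
  connect (steps (edge G) (short m)) v w -> d v w <= n%:R * m.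
Proof.
move=> m0 vw; rewrite -[in n%:R](card_ord n); apply: dist_le_connect => //.
apply: connect_sub vw => a b /andP[ab]; rewrite /= /short /= /matrix_len ab => le.
by apply: connect1; rewrite /= ab.
Qed.

Notation out := (output (n := n)).

Lemma out_lab s v (t : 'I_n) : lab s v = t -> out s v = t.
Proof.
move=> h; apply: val_inj; rewrite val_insubd -/(lab s v) h.
by rewrite ltn_ord.
Qed.

Lemma out_rooted s v : rooted (edge G) K code (asg s) (lab s) -> asg s v != 0%N ->
  out s v \in K /\ lab s v = out s v.
Proof.
by move=> rt /rt[t [tK h _]]; rewrite (out_lab h) h.
Qed.

Definition within s (rho : R) := forall v, asg s v != 0%N -> d v (out s v) <= rho.

(** A new vertex takes the terminal of an old one at distance at most [rho2]. *)
Lemma grow_within M s s' rho1 rho2 : grow_spec G K M s s' ->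
  rooted (edge G) K code (asg s) (lab s) -> 0 <= rho2 ->
  (forall v w, connect (steps (edge G) M) v w -> d v w <= rho2) ->
  within s rho1 -> within s' (rho1 + rho2).
Proof.
move=> gs rt rho0 le wi v v1; have [v0|v0] := eqVneq (asg s v) 0%N.
  have [w [w0 lv vw]] := gs_new gs v0 v1.
  have [wK lw] := out_rooted rt w0.
  rewrite (out_lab (etrans lv lw)) addrC.
  apply: le_trans (dist_triangle len_ge0 conn w _ _) _.
  by apply: lerD; [apply: le|apply: wi].
have [Av lv] := gs_old gs v0; have [_ l0] := out_rooted rt v0.
by rewrite (out_lab (etrans lv l0)) -[leLHS]addr0 lerD ?wi.
Qed.

Lemma grow_spec_none s : rooted (edge G) K code (asg s) (lab s) ->
  grow_spec G K (fun _ _ => false) s s.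
Proof. by move=> rt; split=> // v ->. Qed.

(* The outcome of a round at scale [r] in which [near] tells which vertices were
   sampled to lie in a common cluster; [i] and [j] span a shortest crossing
   edge. *)
Record advance (near : rel 'I_n) s s' (r : R) (i j : 'I_n) : Prop := Advance {
  ad_input : holds_input s';
  ad_rooted : rooted (edge G) K code (asg s') (lab s');
  ad_within : within s' (4 * r);
  ad_scale : scale s' = r;
  ad_scanned : scanned s';
  ad_old : forall v, asg s v != 0%N -> asg s' v = asg s v /\ lab s' v = lab s v;
  ad_reach : forall a b, asg s b != 0%N -> connect (steps (edge G) near) a b ->
    asg s' a != 0%N;
  ad_same : forall a b, asg s a = 0%N -> asg s b = 0%N -> edge G a b -> near a b ->
    near i j \/ len G a b <= gap s ->
    asg s' a = asg s' b /\ (asg s' a != 0%N -> lab s' a = lab s' b);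
  ad_prog : n%:R * gap s <= r -> asg s' i != 0%N }.

Lemma tail_advance near s s1 i j :
  shortest_crossing s i j -> grow_spec G K near s s1 ->
  holds_input s1 -> nmem s1 17 0 0 = i -> gap s1 = gap s ->
  within s1 (3 * scale s1) ->
  advance near s (den n tail s1) (scale s1) i j.
Proof.
move=> [/and3P[/eqP i0 j0 eij] _ gE _] gs inp1 si g1 wi1.
have rt1 := gs_rooted gs.
have [inp2 sc2 H] := den_force inp1 si rt1.
rewrite (_ : den n tail s1 = den n scan (den n force s1)) //.
have m0 : 0 <= gap s by rewrite gE len_ge0.
set s2 := den n force s1 in inp2 sc2 H *.
have [A2 L2] : asg (den n scan s2) = asg s2 /\ lab (den n scan s2) = lab s2.
  by rewrite asg_frame // lab_frame.
have sc3 : scale (den n scan s2) = scale s1 by rewrite -sc2 /scale den_rframe.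
have in3 : holds_input (den n scan s2) by apply: holds_input_den.
have scd := scanned_scan inp2.
set s3 := den n scan s2 in A2 L2 sc3 in3 scd *.
have [old2 rt2 wi2] : [/\ forall v, asg s1 v != 0%N ->
    asg s2 v = asg s1 v /\ lab s2 v = lab s1 v,
    rooted (edge G) K code (asg s2) (lab s2) & within s2 (4 * scale s1)].
  have r0 : 0 <= scale s1.
    have := wi1 j; rewrite (gs_old gs j0).1 => /(_ j0).
    have := dist_ge0 len_ge0 conn j (out s1 j); lra.
  move: H; case: ifP => [/andP[_ le] gs2|_ [A1 L1]].
    split; [exact: gs_old gs2|exact: gs_rooted gs2|].
    (* The forced growth carries a label over a distance of at most [n m <= r]. *)
    have -> : 4 * scale s1 = 3 * scale s1 + scale s1 by ring.
    apply: grow_within gs2 rt1 r0 _ wi1 => v w vw.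
    by apply: le_trans le; apply: short_dist => //; rewrite g1.
  split=> [v||v]; rewrite ?A1 ?L1 // => v1.
  have -> : out s2 v = out s1 v.
    have [_ lE] := out_rooted rt1 v1; apply: out_lab; by rewrite L1 lE.
  by apply: le_trans (wi1 v v1) _; lra.
have up2 v : asg s1 v != 0%N -> asg s2 v != 0%N by move=> h; rewrite (old2 v h).1.
split=> //.
- by rewrite A2 L2.
- by move=> v; rewrite A2 => /wi2; rewrite /out /output -[nmem s3 3 v 0]/(lab s3 v) L2.
- move=> v v0; have [A1 L1] := gs_old gs v0; rewrite -A1 in v0.
  by rewrite A2 L2 -A1 -L1; apply: old2.
- move=> a b b0 /connectP[p]; rewrite A2 => ap bp; apply: up2.
  (* Going back from [b]: a neighbour of an old assigned vertex is assigned by [gs_adj], a neighbour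
     of a newly assigned one by [gs_same]. *)
  elim: p a ap bp => [|c p IH] a /=; first by move=> _ <-; rewrite (gs_old gs b0).1.
  move=> /andP[/andP[ac nac] cp] bp; have c1 := IH _ cp bp.
  have [a0|a0] := eqVneq (asg s a) 0%N; last by rewrite (gs_old gs a0).1.
  have [c0|c0] := eqVneq (asg s c) 0%N; last exact: (gs_adj gs c0 ac nac).
  by rewrite (gs_same gs a0 c0 ac nac).1.
- move=> a b a0 b0 eab nab nij; rewrite A2 L2.
  have [A1 L1] := gs_same gs a0 b0 eab nab.
  have [a1|a1] := eqVneq (asg s1 a) 0%N; last first.
    have b1 : asg s1 b != 0%N by rewrite -A1.
    have [-> ->] := old2 _ a1; have [-> ->] := old2 _ b1.
    by rewrite A1 L1 -?A1.
  have b1 : asg s1 b = 0%N by rewrite -A1.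
  (* A forced growth means that [i] was still unassigned, which excludes [near i j]; so the edge
     from [a] to [b] is short and its ends are treated alike. *)
  move: H; case: ifP => [/andP[/eqP i1 _] gs2|_ [-> _]]; last by rewrite a1 b1.
  apply: (gs_same gs2 a1 b1 eab); rewrite /short /= /matrix_len eab g1.
  case: nij => // nij; have := gs_adj gs j0 eij nij.
  by rewrite i1.
- move=> le; rewrite A2; have [i1|i1] := eqVneq (asg s1 i) 0%N; last exact: up2.
  move: H; rewrite i1 eqxx g1 le /= => gs2; apply: (gs_adj gs2 _ eij (b := j)).
    by rewrite (gs_old gs j0).1.
  by rewrite /short /= /matrix_len eij gE.
Qed.

Definition together (P : {set {set 'I_n}}) : rel 'I_n :=
  [rel u v | [exists S in P, (u \in S) && (v \in S)]].

Lemma together_sym P : symmetric (together P).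
Proof. by move=> u v; apply: eq_existsb => S; rewrite [(u \in S) && _]andbC. Qed.

Lemma not_separates P u v : partition P [set: 'I_n] ->
  ~~ separates P u v -> together P u v.
Proof.
move=> /and3P[/eqP cov _ _] /existsPn H.
have: u \in cover P by rewrite cov inE.
move=> /bigcupP[S SP uS]; apply/existsP; exists S.
by have := H S; rewrite SP uS /= negbK.
Qed.

(** Clusters are disjoint, so a walk of [together] steps never leaves the block of [v]. *)
Lemma together_dist P (r : R) v w : bounded_partition d r P ->
  connect (steps (edge G) (together P)) v w -> d v w <= r.
Proof.
move=> [pP bP]; have /and3P[/eqP cov tI _] := pP => vw.
have blk x y : together P x y -> pblock P x = pblock P y.
  by move=> /existsP[S /andP[SP /andP[xS yS]]]; rewrite !(def_pblock tI SP).
have {}vw : pblock P v = pblock P w.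
  move/connectP: vw => [p + ->]; elim: p v => //= y p IH v /andP[/andP[_ vy] yp].
  by rewrite (blk _ _ vy) IH.
have vc x : x \in cover P by rewrite cov inE.
apply: (bP (pblock P v)); rewrite ?pblock_mem ?mem_pblock //.
by rewrite vw mem_pblock.
Qed.

Definition sound s :=
  [/\ holds_input s, rooted (edge G) K code (asg s) (lab s),
      within s (4 * scale s), 0 <= scale s & scanned s].

(** Draws require a positive scale; at scale 0 a round is [tail] alone, described by an empty
    [near]. *)
Lemma advance_tail s i j : sound s -> shortest_crossing s i j ->
  let s1 := den n rescale s in
  advance (fun _ _ => false) s (den n tail s1) (scale s1) i j.
Proof.
move=> [inp rt wi r0 _] sc s1; have [r1 g1 N1 R1] := den_rescale s.
have r2 : scale s + scale s <= scale s1 by rewrite r1 le_max lexx.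
have E : (asg s1 = asg s) * (lab s1 = lab s) by rewrite /asg /lab N1.
apply: tail_advance => //.
- have := grow_spec_none rt; by apply: grow_spec_ext => //; rewrite E.
- by apply: holds_input_den.
- by rewrite N1; case: sc.
- move=> v; rewrite E /out /output N1 => /wi; move/le_trans; apply.
  by lra.
Qed.

(** Doubling makes the old radius [4 r] at most [2 r'], and a cluster diameter adds [r']: this gives
    the [3 r'] expected by [tail_advance]. *)
Lemma advance_sampled P s i j : sound s -> shortest_crossing s i j ->
  let s1 := den n rescale s in
  bounded_partition d (scale s1) P ->
  advance (together P) s (den n sampled_tail (write_partition s1 5 P)) (scale s1) i j.
Proof.
move=> [inp rt wi r0 _] sc s1 bP; have [r1 g1 N1 R1] := den_rescale s.
have r2 : scale s + scale s <= scale s1 by rewrite r1 le_max lexx.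
have E : (asg s1 = asg s) * (lab s1 = lab s) by rewrite /asg /lab N1.
have inp1 : holds_input s1 by apply: holds_input_den.
set s2 := write_partition s1 5 P.
have [|||ag gs] := @den_grow R n G K sym (NLe (NConst 1) (NGet 5 (reg 10) (reg 11)))
   s2 (together P) (@together_sym P).
- by case: inp1.
- move=> s' a b [ag _] h1 h2; rewrite /= h1 h2 ag //= !ltn_ord /= lt0b.
  apply/existsP/idP => [[u /existsP[v /and3P[/eqP/val_inj -> /eqP/val_inj -> //]]]|h].
  by exists a; apply/existsP; exists b; rewrite !eqxx.
- by have := rt; rewrite -[asg s2]/(asg s1) -[lab s2]/(lab s1) !E.
set s3 := den n (grow _) s2 in ag gs.
have sc3 : scale s3 = scale s1 by case: ag => _; apply.
rewrite -sc3 (_ : den n sampled_tail s2 = den n tail s3) //.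
have gs' : grow_spec G K (together P) s s3.
  by apply: grow_spec_ext gs => //; rewrite -?E.
have r10 : 0 <= scale s1 by lra.
have wi3 : within s3 (2 * scale s1 + scale s1).
  apply: grow_within gs' rt r10 _ _ => [v w|v v0]; first exact: together_dist.
  by apply: le_trans (wi _ v0) _; lra.
apply: (tail_advance sc gs').
- by apply: (holds_input_frame _ _ _ inp1) => *; case: ag => h1 h2; rewrite ?h1 ?h2.
- by case: ag => -> // _; rewrite /= N1; case: sc.
- by case: ag => _ h; rewrite /gap h.
- by move=> v /wi3; rewrite sc3; lra.
Qed.

End Round.

(** * The expected stretch of an edge *)

Section Probability.
Variables (R : realType) (A : finType) (mu : fdist R A).
Implicit Types (E F : pred A).

Definition prob E : R := \sum_(a | E a) mu a.

Lemma prob_ge0 E : 0 <= prob E.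
Proof. by apply: sumr_ge0 => a _; apply: pmf_ge0. Qed.

Lemma prob_mono E F : (forall a, 0 < mu a -> E a -> F a) -> prob E <= prob F.
Proof.
move=> H; rewrite /prob big_mkcond [leRHS]big_mkcond; apply: ler_sum => a _.
have := pmf_ge0 mu a; rewrite le_eqVlt => /orP[/eqP <-|a0]; first by rewrite !if_same.
by case: ifP => [/(H _ a0) ->|_] //; case: ifP => _ //; apply: ltW.
Qed.

Lemma prob_le1 E : prob E <= 1.
Proof.
by rewrite -(pmf_sum1 mu) -[leRHS]/(prob xpredT); apply: prob_mono.
Qed.

Lemma prob_or E F : prob [pred a | E a || F a] <= prob E + prob F.
Proof.
rewrite /prob big_mkcond [X in _ <= X + _]big_mkcond [X in _ <= _ + X]big_mkcond.
rewrite -big_split; apply: ler_sum => a _ /=.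
have := pmf_ge0 mu a; case: (E a); case: (F a) => /=; lra.
Qed.

Lemma mean_le (f : A -> R) (E F : pred A) (c0 c1 c2 : R) :
  (forall a, 0 < mu a -> f a <= c0 + (E a)%:R * c1 + (F a)%:R * c2) ->
  \sum_a mu a * f a <= c0 + prob E * c1 + prob F * c2.
Proof.
move=> H; apply: (@le_trans _ _
  (\sum_a mu a * (c0 + (E a)%:R * c1 + (F a)%:R * c2))).
  apply: ler_sum => a _; have := pmf_ge0 mu a.
  by rewrite le_eqVlt => /orP[/eqP <-|a0]; rewrite ?mul0r // ler_wpM2l ?H ?ltW.
have -> : \sum_a mu a * (c0 + (E a)%:R * c1 + (F a)%:R * c2) =
    \sum_a (mu a * c0 + (if E a then mu a else 0) * c1 + (if F a then mu a else 0) * c2).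
  by apply: eq_bigr => a _; case: (E a); case: (F a) => /=; ring.
by rewrite 2!big_split /= -!mulr_suml pmf_sum1 mul1r -!big_mkcond.
Qed.

End Probability.

(** * The logarithmic count of relevant rounds *)

Section Profile.
Variables (R : realType) (beta delta : R).
Hypotheses (beta2 : 2 <= beta) (delta0 : 0 <= delta).

(** The bound [ln (1 + x) <= x] at [x = - 2^-1]. *)
Lemma ln2_ge : 2^-1 <= ln (2 : R).
Proof.
have := @le_ln1Dx R (- 2^-1); have -> : 1 + - 2^-1 = 2^-1 :> R by lra.
rewrite lnV ?posrE //; lra.
Qed.

(* Twice an upper bound for the expected number of rounds, at scales above [r],
   in which an edge at distance [delta] from the terminals is unassigned and can
   be reached from them. *)
Definition profile (r : R) : R :=
  2 + 2 * Num.max 0 (ln (2 * beta * delta / Num.max r (delta / 8))).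

Lemma profile_ge2 r : 2 <= profile r.
Proof.
rewrite /profile; set l := ln _.
have : 0 <= Num.max 0 l by rewrite le_max lexx.
lra.
Qed.

Lemma profile_le (r r' : R) : 0 < delta -> r <= r' -> profile r' <= profile r.
Proof.
have b2 := beta2; move=> d0 rr'.
rewrite lerD2l ler_pM2l // ge_max !le_max lexx /=; apply/orP; right.
have D0 : 0 < 2 * beta * delta. by rewrite mulr_gt0 //; lra.
have rho0 x : 0 < Num.max x (delta / 8) by rewrite lt_max; apply/orP; right; lra.
rewrite ler_ln ?posrE ?divr_gt0 // ler_pM2l // lef_pV2 ?posrE //.
by rewrite ge_max !le_max rr' lexx orbT.
Qed.

(** If [r' >= 2 beta delta], then [profile r' = 2] and [p <= 1/2], so [1 + 2 p <= 2]. Otherwise the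
    logarithm drops by at least [ln 2 >= 1/2], and its factor 2 pays for the 1. *)
Lemma profile_step (r r' p : R) : 0 <= r -> r + r <= r' -> 0 < r' -> delta <= 4 * r' ->
  0 <= p -> p <= 1 -> p * r' <= beta * delta ->
  1 + p * profile r' <= profile r.
Proof.
have [b2 dd] := (beta2, delta0); move=> r0 rr' r'0 dr' p0 p1 pr'.
have g0 := profile_ge2 r.
have m' : Num.max r' (delta / 8) = r' by apply/max_idPl; lra.
have [le|lt] := leP (2 * beta * delta) r'.
  have -> : profile r' = 2.
    rewrite /profile m' (_ : Num.max 0 _ = 0) ?mulr0 ?addr0 //; apply/max_idPl.
    by rewrite ln_le0 // ler_pdivrMr // mul1r.
  have : p * r' <= 2^-1 * r' by lra.
  rewrite ler_pM2r //; lra.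
(* The cut-off [delta / 8] lies a factor 2 below [r' >= delta / 4], just as [r] lies a factor 2
   below [r']. *)
set rho := Num.max r (delta / 8).
have d0 : 0 < delta.
  by rewrite lt_neqAle delta0 andbT eq_sym; apply/eqP => d0; move: lt; rewrite d0; lra.
have rho0 : 0 < rho by rewrite lt_max; apply/orP; right; lra.
have rho2 : 2 * rho <= r'.
  by rewrite mulrC -ler_pdivlMr // ge_max; apply/andP; split; lra.
have l0 : 0 <= ln (2 * beta * delta / r').
  by rewrite ln_ge0 // ler_pdivlMr // mul1r ltW.
have l1 : ln 2 + ln (2 * beta * delta / r') <= ln (2 * beta * delta / rho).
  have D0 : 0 < 2 * beta * delta by lra.
  have q1 : 0 < 2 * beta * delta / r' by rewrite divr_gt0.
  have q2 : 0 < 2 * beta * delta / rho by rewrite divr_gt0.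
  have q3 : 0 < 2 * (2 * beta * delta / r') by rewrite mulr_gt0.
  rewrite -lnM ?posrE // ler_ln ?posrE // mulrCA ler_pM2l //.
  by rewrite ler_pdivrMr // mulrC ler_pdivlMr // mulrC.
have l2 := ln2_ge.
have e' : profile r' = 2 + 2 * ln (2 * beta * delta / r').
  by rewrite /profile m' (_ : Num.max 0 _ = ln (2 * beta * delta / r')) //; apply/max_idPr.
have e : 2 + 2 * ln (2 * beta * delta / rho) <= profile r.
  by rewrite /profile lerD2l ler_pM2l // le_max lexx orbT.
have : p * profile r' <= 1 * profile r' by apply: ler_wpM2r => //; have := profile_ge2 r'; lra.
rewrite mul1r; lra.
Qed.

(** At scale 0 the argument of the logarithm is [16 beta], so the profile is at most
    [2 + 10 ln beta], and [2 <= 4 ln beta]. *)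
Lemma profile0 : profile 0 <= 14 * ln beta.
Proof.
have [b2 dd] := (beta2, delta0); have l2 := ln2_ge.
have lb : ln 2 <= ln beta by rewrite ler_ln ?posrE //; lra.
rewrite /profile; have -> : Num.max 0 (delta / 8) = delta / 8 by apply/max_idPr; lra.
suff : Num.max 0 (ln (2 * beta * delta / (delta / 8))) <= 5 * ln beta by lra.
rewrite ge_max; apply/andP; split; first lra.
(* For [delta = 0] the quotient is 0 by convention, and so is [ln 0]. *)
have [->|d0] := eqVneq delta 0; first by rewrite mulr0 mul0r ln0 //; lra.
have -> : 2 * beta * delta / (delta / 8) = 2 ^+ 4 * beta by field.
rewrite lnM ?posrE ?exprn_gt0 //; last lra.
rewrite lnXn // -[ln 2 *+ 4]mulr_natl. lra.
Qed.

End Profile.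

(** * The potential of an edge and its evolution in one round *)

Section Potential.
Variables (R : realType) (n : nat) (G : wgraph R 'I_n) (K : {set 'I_n}).
Variables (beta : R) (delta : 'I_n -> 'I_n -> R).
Implicit Types (s : store R).
Hypothesis sym : symmetric (edge G).
Hypothesis lsym : forall u v, edge G u v -> len G u v = len G v u.
Hypothesis len_ge0 : forall u v, edge G u v -> 0 <= len G u v.
Hypothesis conn : connected_graph (edge G).
Hypothesis beta2 : 2 <= beta.

(* [delta u v] is the distance from {u, v} to the terminals. *)
Hypothesis delta_ge0 : forall u v, 0 <= delta u v.
Hypothesis delta_le : forall (u v w t : 'I_n), w \in [:: u; v] -> t \in K ->
  delta u v <= dist G w t.
Hypothesis delta_min : forall u v : 'I_n, exists w t : 'I_n,
  [/\ w \in [:: u; v], t \in K & delta u v = dist G w t].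

Notation code := (@nat_of_ord n).
Notation d := (dist G).
Notation out := (output (n := n)).
Local Notation asg := (@asg R n).
Local Notation lab := (@lab R n).

(** The bound while exactly one end is assigned. It is constant up to scale [2 x]; the coefficients
    are balanced in [mean_one]. *)
Definition half_cost (x r : R) := 12 * Num.max r (2 * x) + 25 * x.

(* An upper bound for the expected final distance between the terminals of the
   ends of an edge, in terms of the current state. *)
Definition potential (u v : 'I_n) s : R :=
  let x := beta * len G u v in
  if asg s u != 0%N then
    if asg s v != 0%N then d (out s u) (out s v) else half_cost x (scale s)
  else
    if asg s v != 0%N then half_cost x (scale s)
    else 73 * x * profile beta (delta u v) (scale s).

Definition ready s := sound G K s /\ forall t, t \in K -> asg s t != 0%N.

Section Step.
Variables (near : rel 'I_n) (s s' : store R) (r' : R) (i j : 'I_n).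
Hypothesis rdy : ready s.
Hypothesis sc : shortest_crossing G s i j.
Hypothesis r'E : r' = Num.max (scale s + scale s) (gap s).
Hypothesis ad : advance G K near s s' r' i j.

Lemma step_old v : asg s v != 0%N -> asg s' v != 0%N /\ out s' v = out s v.
Proof.
move=> v0; have [A L] := ad_old ad v0; rewrite A; split=> //.
have [[_ rt _ _ _] _] := rdy.
by have [_ l] := out_rooted rt v0; apply: out_lab; rewrite L l.
Qed.

Lemma gap_ge0 : 0 <= gap s.
Proof. by case: sc => /and3P[_ _ ij] _ -> _; apply: len_ge0. Qed.

Lemma step_scale : [/\ 0 <= scale s, 0 <= r' & scale s + scale s <= r'].
Proof.
have [[_ _ _ r0 _] _] := rdy; have : scale s + scale s <= r'.
  by rewrite r'E le_max lexx.
by split=> //; lra.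
Qed.

Lemma step_both u v : asg s u != 0%N -> asg s v != 0%N ->
  potential u v s' = potential u v s.
Proof.
move=> u0 v0; have [u1 eu] := step_old u0; have [v1 ev] := step_old v0.
by rewrite /potential u0 v0 u1 v1 eu ev.
Qed.

Lemma dist_out u v (ru rv : R) : edge G u v ->
  d u (out s' u) <= ru -> d v (out s' v) <= rv ->
  d (out s' u) (out s' v) <= ru + rv + len G u v.
Proof.
move=> uv hu hv; have le := dist_le_edge len_ge0 uv.
have := dist_triangle len_ge0 conn u (out s' u) (out s' v).
have := dist_triangle len_ge0 conn v u (out s' v).
rewrite [d (out s' u) u](dist_sym len_ge0 conn sym lsym); lra.
Qed.

(** The old end is within [4 r <= 2 r'] of its terminal, the new one within [4 r']. *)
Lemma step_one_assigned u v : edge G u v -> asg s u != 0%N -> asg s' v != 0%N ->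
  d (out s' u) (out s' v) <= 6 * r' + len G u v.
Proof.
move=> uv u0 v1; have [r0 r'0 rr'] := step_scale.
have [u1 eu] := step_old u0; have [[_ _ wi _ _] _] := rdy.
have := dist_out uv _ (ad_within ad v1); rewrite eu => /(_ _ (wi _ u0)); lra.
Qed.

Lemma step_one u v : edge G u v -> asg s u != 0%N -> asg s v = 0%N ->
  potential u v s' <= 6 * r' + len G u v +
       (~~ near v u)%:R * half_cost (beta * len G u v) r'.
Proof.
move=> uv u0 v0; have l0 := len_ge0 uv; have [r0 r'0 rr'] := step_scale.
have [u1 eu] := step_old u0.
have b2 := beta2.
have x0 : 0 <= beta * len G u v by rewrite mulr_ge0 //; lra.
have h0 : 0 <= half_cost (beta * len G u v) r'.
  have : 0 <= Num.max r' (2 * (beta * len G u v)) by rewrite le_max r'0.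
  by rewrite /half_cost; lra.
rewrite /potential u1 (ad_scale ad); case: ifPn => [v1|].
  have := step_one_assigned uv u0 v1.
  have : 0 <= (~~ near v u)%:R * half_cost (beta * len G u v) r'.
    by rewrite mulr_ge0 ?ler0n.
  lra.
case: (boolP (near v u)) => [nvu|_ _]; last by rewrite mul1r; lra.
move/negP; case; apply: (ad_reach ad u0); apply: connect1.
by rewrite /steps /= sym uv.
Qed.

(* A crossing edge is at least as long as the gap, so a scale above twice [x]
   was reached by doubling. *)
Lemma step_double u v : edge G u v -> asg s u != 0%N -> asg s v = 0%N ->
  2 * (beta * len G u v) < r' -> r' = scale s + scale s.
Proof.
move=> uv u0 v0; have b2 := beta2; have l0 := len_ge0 uv.
have lx : 2 * len G u v <= beta * len G u v by apply: ler_wpM2r.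
have m_le : gap s <= len G u v.
  by case: sc => _ _ _ /(_ v u); rewrite (lsym uv); apply; rewrite /crossing v0 u0 sym uv.
rewrite r'E; case: (leP (scale s + scale s) (gap s)) => // _ lt.
have: gap s < gap s by lra.
by rewrite ltxx.
Qed.

Lemma step_one_small u v : edge G u v -> asg s u != 0%N -> asg s v = 0%N ->
  r' <= 2 * (beta * len G u v) -> potential u v s' <= potential u v s.
Proof.
move=> uv u0 v0 small; have l0 := len_ge0 uv; have [r0 r'0 rr'] := step_scale.
have b2 := beta2; have lx : 2 * len G u v <= beta * len G u v by apply: ler_wpM2r.
have [u1 eu] := step_old u0.
rewrite /potential u0 u1 v0 eqxx /= (ad_scale ad) /half_cost.
rewrite (max_idPr _); last lra.
rewrite (max_idPr _); last lra.
by case: ifPn => // v1; have := step_one_assigned uv u0 v1; lra.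
Qed.

(** Unless the edge is cut, or is longer than the gap while [i] and [j] are cut, its ends stay
    unassigned together or get one terminal. Otherwise the cost is at most [8 r' + l] or
    [half_cost], both below [12 r' + 49 x]. *)
Lemma step_none u v : edge G u v -> asg s u = 0%N -> asg s v = 0%N ->
  potential u v s' <=
    [|| ~~ near u v | (gap s < len G u v) && ~~ near i j]%:R
      * (12 * r' + 49 * (beta * len G u v))
    + ((asg s' u == 0%N) && (asg s' v == 0%N))%:R
      * (73 * (beta * len G u v) * profile beta (delta u v) r').
Proof.
move=> uv u0 v0; have l0 := len_ge0 uv; have [r0 r'0 rr'] := step_scale.
have b2 := beta2; have lx : 2 * len G u v <= beta * len G u v by apply: ler_wpM2r.
have hle : half_cost (beta * len G u v) r' <= 12 * r' + 49 * (beta * len G u v).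
  have : Num.max r' (2 * (beta * len G u v)) <= r' + 2 * (beta * len G u v).
    by rewrite ge_max; apply/andP; split; lra.
  by rewrite /half_cost; lra.
set bad := [|| _ | _]; have nb : ~~ bad ->
    asg s' u = asg s' v /\ (asg s' u != 0%N -> lab s' u = lab s' v).
  rewrite /bad negb_or negbK negb_and negbK -leNgt => /andP[nuv h].
  by apply: (ad_same ad u0 v0 uv nuv); case/orP: h; [right|left].
have B0 : 0 <= bad%:R * (12 * r' + 49 * (beta * len G u v)).
  by rewrite mulr_ge0 ?ler0n //; lra.
rewrite /potential (ad_scale ad).
case: (eqVneq (asg s' u) 0%N) => u1; case: (eqVneq (asg s' v) 0%N) => v1 /=;
  rewrite ?mul1r ?mul0r ?addr0; first lra.
- case: (boolP bad) => [_|/nb[e _]]; first by rewrite mul1r.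
  by rewrite -e u1 in v1.
- case: (boolP bad) => [_|/nb[e _]]; first by rewrite mul1r.
  by rewrite e v1 in u1.
- case: (boolP bad) => [_|/nb[e /(_ u1) eL]].
    rewrite mul1r.
    have := dist_out uv (ad_within ad u1) (ad_within ad v1); lra.
  have [_ lv] := out_rooted (ad_rooted ad) v1.
  by rewrite (out_lab (etrans eL lv)) distxx // mul0r.
Qed.

(** An assigned end would have a terminal within [4 r'], nearer than [delta] allows. *)
Lemma step_far u v : asg s u = 0%N -> asg s v = 0%N -> 4 * r' < delta u v ->
  potential u v s' = 73 * (beta * len G u v) * profile beta (delta u v) r'.
Proof.
move=> u0 v0 lt.
have z w : w \in [:: u; v] -> asg s' w = 0%N.
  move=> wuv; apply/eqP/negPn/negP => w1.
  have [oK _] := out_rooted (ad_rooted ad) w1.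
  by have := delta_le wuv oK; have := ad_within ad w1; lra.
by rewrite /potential (ad_scale ad) !z // !inE eqxx ?orbT.
Qed.

(** No probability is available at scale 0, but the cost [12 r' + 49 x] shrinks to [49 x], below
    [73 x] times a profile of at least 2. *)
Lemma step_zero u v : edge G u v -> asg s u = 0%N -> asg s v = 0%N -> r' = 0 ->
  potential u v s' <= potential u v s.
Proof.
move=> uv u0 v0 r'z; have l0 := len_ge0 uv; have [r0 _ rr'] := step_scale.
have b2 := beta2; have x0 : 0 <= beta * len G u v by rewrite mulr_ge0 //; lra.
have rz : scale s = 0 by lra.
have [/andP[/eqP u1 /eqP v1]|uv1] := boolP ((asg s' u == 0%N) && (asg s' v == 0%N)).
  by rewrite /potential u0 v0 u1 v1 /= (ad_scale ad) r'z rz.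
apply: le_trans (step_none uv u0 v0) _; rewrite (negPf uv1) mul0r addr0 r'z.
rewrite /potential u0 v0 /= mulr0 add0r.
apply: (@le_trans _ _ (1 * (49 * (beta * len G u v)))).
  by rewrite ler_wpM2r ?lern1 ?leq_b1 //; lra.
have : 73 * (beta * len G u v) * 2 <=
    73 * (beta * len G u v) * profile beta (delta u v) (scale s).
  by rewrite ler_wpM2l ?profile_ge2 //; lra.
lra.
Qed.

End Step.

Lemma delta_sym u v : delta u v = delta v u.
Proof.
suff le a b : delta a b <= delta b a by apply/eqP; rewrite eq_le !le.
have [w [t [wba tK ->]]] := delta_min b a; apply: delta_le => //.
by move: wba; rewrite !inE orbC.
Qed.

Lemma potential_sym u v s : edge G u v -> potential u v s = potential v u s.
Proof.
move=> uv; rewrite /potential (lsym uv) delta_sym; case: ifP; case: ifP => //.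
by rewrite (dist_sym len_ge0 conn sym lsym).
Qed.

Lemma advance_zero near s s' i j u v : ready s -> shortest_crossing G s i j ->
  Num.max (scale s + scale s) (gap s) = 0 ->
  advance G K near s s' 0 i j ->
  edge G u v -> potential u v s' <= potential u v s.
Proof.
move=> rdy sc r'E ad; have b2 := beta2.
have one a b : edge G a b -> asg s a != 0%N -> asg s b = 0%N ->
    potential a b s' <= potential a b s.
  move=> ab a0 b0; apply: (step_one_small rdy (esym r'E) ad) => //.
  by rewrite mulr_ge0 // mulr_ge0 ?len_ge0 //; lra.
move=> uv; have [u0|u0] := eqVneq (asg s u) 0%N;
  have [v0|v0] := eqVneq (asg s v) 0%N.
- exact: (step_zero rdy (esym r'E) ad).
- by rewrite !(potential_sym _ uv); apply: one => //; rewrite sym.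
- exact: one.
- by rewrite (step_both rdy ad).
Qed.

(** * Averaging over the sampled partition *)

Section Mean.
Variables (S : sampler R 'I_n) (t : nat).
Hypothesis dec : decomposes_within t d beta S.
Variables (s : store R) (after : {set {set 'I_n}} -> store R) (i j : 'I_n) (r' : R).
Hypothesis rdy : ready s.
Hypothesis sc : shortest_crossing G s i j.
Hypothesis r'E : r' = Num.max (scale s + scale s) (gap s).
Hypothesis r'_gt0 : 0 < r'.
Notation mu := (law S r').
Hypothesis ad : forall P, 0 < mu P -> advance G K (together P) s (after P) r' i j.

Lemma cut_prob a b : prob mu (fun P => ~~ together P a b) * r' <= beta * d a b.
Proof.
have [_ part cut] := dec r'_gt0; rewrite -ler_pdivlMr //.
apply: le_trans (cut a b); apply: prob_mono => P /part[pP _].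
by apply: contraNT => /(not_separates pP).
Qed.

Lemma cut_edge a b : edge G a b ->
  prob mu (fun P => ~~ together P a b) * r' <= beta * len G a b.
Proof.
move=> ab; apply: le_trans (cut_prob a b) _.
have b2 := beta2; apply: ler_wpM2l; first lra.
exact: dist_le_edge.
Qed.

(** A union bound over the edges of the walk. *)
Lemma cut_walk a p : path (edge G) a p ->
  prob mu (fun P => ~~ path (steps (edge G) (together P)) a p) * r'
    <= beta * walk_len (len G) a p.
Proof.
elim: p a => [|b p IH] a /=.
  by move=> _; rewrite mulr0 /prob big_pred0 ?mul0r.
move=> /andP[ab bp]; rewrite mulrDr.
apply: le_trans (lerD (cut_edge ab) (IH _ bp)); rewrite -mulrDl ler_pM2r //.
apply: le_trans (prob_or _ _ _); apply: prob_mono => P _.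
by rewrite /= {1}/steps /= ab /= negb_and.
Qed.

(** A walk from the end nearest to the terminals that is not cut would assign that end. The estimate
    holds for every such walk, so the infimum gives the distance. *)
Lemma survival u v : asg s u = 0%N -> asg s v = 0%N ->
  prob mu (fun P => (asg (after P) u == 0%N) && (asg (after P) v == 0%N)) * r'
    <= beta * delta u v.
Proof.
move=> u0 v0; have [w [z [wuv zK ->]]] := delta_min u v; have b2 := beta2.
have b0 : 0 < beta by lra.
rewrite -ler_pdivrMl // ; apply: le_dist => // p wp pz.
rewrite ler_pdivrMl //; apply: le_trans (cut_walk wp).
rewrite ler_pM2r //; apply: prob_mono => P muP /andP[/eqP u1 /eqP v1].
apply/negP => wz; have z0 : asg s z != 0%N by case: rdy => _; apply.
have : asg (after P) w != 0%N.
  by apply: (ad_reach (ad muP) z0); apply/connectP; exists p.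
by move: wuv; rewrite !inE => /orP[]/eqP ->; rewrite ?u1 ?v1.
Qed.

(** For [r' > 2 x] the scale has doubled, [p r' <= x] and [p <= 1/2], so [6 r' + l + p (12 r' + 25
    x) <= 12 r + x/2 + 12 x + 25 x/2 = 12 r + 25 x]. This determines the 25. *)
Lemma mean_one u v : edge G u v -> asg s u != 0%N -> asg s v = 0%N ->
  \sum_P mu P * potential u v (after P) <= potential u v s.
Proof.
move=> uv u0 v0; have l0 := len_ge0 uv; have b2 := beta2.
have lx : 2 * len G u v <= beta * len G u v by apply: ler_wpM2r.
have [small|large] := leP r' (2 * (beta * len G u v)).
  have := @mean_le _ _ mu (fun P => potential u v (after P)) pred0 pred0
    (potential u v s) 0 0; rewrite !mulr0 !addr0; apply=> P /ad aP.
  by rewrite !mulr0 !addr0; apply: (step_one_small rdy r'E aP).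
set p := prob mu (fun P => ~~ together P v u).
have pr : p * r' <= beta * len G u v by rewrite (lsym uv); apply: cut_edge; rewrite sym.
have p0 : 0 <= p by apply: prob_ge0.
have p2 : p <= 2^-1 by rewrite -(ler_pM2r r'_gt0); lra.
have px : p * (beta * len G u v) <= 2^-1 * (beta * len G u v) by apply: ler_wpM2r => //; lra.
apply: (@le_trans _ _ (6 * r' + len G u v + p * half_cost (beta * len G u v) r')).
  have := @mean_le _ _ mu (fun P => potential u v (after P))
    (fun P => ~~ together P v u) pred0 (6 * r' + len G u v)
    (half_cost (beta * len G u v) r') 0.
  rewrite !mulr0 !addr0; apply=> P /ad aP.
  by rewrite !mulr0 !addr0; apply: (step_one rdy r'E aP).
have rE := step_double sc r'E uv u0 v0 large.
rewrite /potential u0 v0 /= /half_cost (max_idPl _); last lra.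
have : scale s <= Num.max (scale s) (2 * (beta * len G u v)) by rewrite le_max lexx.
rewrite rE in pr p2 px *; lra.
Qed.

(** Separation costs at most [2 * 12 x + 49 x = 73 x] on average, which is the drop of the potential
    granted by [profile_step]. *)
Lemma mean_none u v : edge G u v -> asg s u = 0%N -> asg s v = 0%N ->
  \sum_P mu P * potential u v (after P) <= potential u v s.
Proof.
move=> uv u0 v0; have l0 := len_ge0 uv; have b2 := beta2.
set x := beta * len G u v.
have x0 : 0 <= x by rewrite mulr_ge0 //; lra.
have [r0 r'0 rr'] := step_scale rdy r'E.
have [far|close] := ltP (4 * r') (delta u v).
  have := @mean_le _ _ mu (fun P => potential u v (after P)) pred0 pred0
    (potential u v s) 0 0; rewrite !mulr0 !addr0; apply=> P /ad aP.
  rewrite !mulr0 !addr0 (step_far aP u0 v0 far) /potential u0 v0 /=.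
  by apply: ler_wpM2l; [rewrite mulr_ge0|apply: profile_le => //; lra].
pose bad P := [|| ~~ together P u v | (gap s < len G u v) && ~~ together P i j].
pose surv P := (asg (after P) u == 0%N) && (asg (after P) v == 0%N).
(* The edge from [i] to [j] has the length of the gap; when that is below [l], cutting it is no
   likelier than the bound for the edge itself. *)
have pb : prob mu bad * r' <= 2 * x.
  apply: (@le_trans _ _ ((prob mu (fun P => ~~ together P u v) +
    prob mu (fun P => (gap s < len G u v) && ~~ together P i j)) * r')).
    by rewrite ler_pM2r //; apply: prob_or.
  rewrite mulrDl (_ : 2 * x = x + x); last by ring.
  apply: lerD; first exact: cut_edge.
  have [lt|_] := ltP (gap s) (len G u v); last by rewrite /prob big_pred0 ?mul0r.
  have [/and3P[_ _ ij] _ gE _] := sc.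
  apply: le_trans (cut_edge ij) _; rewrite -gE; apply: ler_wpM2l; first lra.
  exact: ltW.
have := @mean_le _ _ mu (fun P => potential u v (after P)) bad surv 0
    (12 * r' + 49 * x) (73 * x * profile beta (delta u v) r').
rewrite add0r => /(_ _)/le_trans; apply=> [P /ad aP|].
  by rewrite add0r; apply: (step_none rdy r'E aP).
have := profile_step beta2 (delta_ge0 u v) r0 rr' r'_gt0 close (prob_ge0 _ surv)
  (prob_le1 _ surv) (survival u0 v0).
move=> /(ler_wpM2l x0) H; rewrite {1}/potential u0 v0 /= -/x.
have pbx : prob mu bad * x <= 1 * x by apply: ler_wpM2r => //; apply: prob_le1.
have -> : prob mu surv * (73 * x * profile beta (delta u v) r') =
   73 * (x * (1 + prob mu surv * profile beta (delta u v) r')) - 73 * x by ring.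
lra.
Qed.

Lemma mean_potential u v : edge G u v ->
  \sum_P mu P * potential u v (after P) <= potential u v s.
Proof.
move=> uv; have [u0|u0] := eqVneq (asg s u) 0%N;
  have [v0|v0] := eqVneq (asg s v) 0%N.
- exact: mean_none.
- rewrite (potential_sym _ uv); under eq_bigr do rewrite (potential_sym _ uv).
  by apply: mean_one => //; rewrite sym.
- exact: mean_one.
- have := @mean_le _ _ mu (fun P => potential u v (after P)) pred0 pred0
    (potential u v s) 0 0; rewrite !mulr0 !addr0; apply=> P /ad aP.
  by rewrite !mulr0 !addr0 (step_both rdy aP).
Qed.

End Mean.

End Potential.

(** * Polynomial bounds *)

(** In this form products just add exponents, and the base is at least 2 even at [m = 0]. *)
Lemma poly_boundedP (t : nat -> nat) :
  poly_bounded t <-> exists k, forall m, (t m <= (m + 2) ^ k)%N.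
Proof.
have mono a b k : (a <= b)%N -> (a ^ k <= b ^ k)%N by case: k => // k; rewrite leq_exp2r.
split=> -[k H].
  exists (k + k.+1)%N => m; apply: leq_trans (H m) _.
  rewrite -[X in (_ + X)%N]muln1 -mulnDr expnD leq_mul //.
    apply: (@leq_trans (2 ^ k)); first exact: ltnW (ltn_expl _ _).
    by apply: mono; rewrite leq_addl.
  have h : (m ^ k <= (m + 2) ^ k)%N by apply: mono; rewrite leq_addr.
  have h0 : (0 < (m + 2) ^ k)%N by rewrite expn_gt0 addn2.
  rewrite expnS; nia.
exists (3 ^ k)%N => -[|m]; apply: leq_trans (H _) _.
  by rewrite add0n; apply: leq_trans (leq_addl _ _); apply: mono.
apply: leq_trans (leq_addr _ _).
apply: (@leq_trans ((3 * m.+1) ^ k)); first by apply: mono; lia.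
rewrite expnMn leq_mul2l; apply/orP; right; apply: leq_pexp2l => //.
exact: ltnW (ltn_expl _ _).
Qed.

Lemma poly_bounded_add t1 t2 :
  poly_bounded t1 -> poly_bounded t2 -> poly_bounded (fun m => t1 m + t2 m)%N.
Proof.
move=> /poly_boundedP[k1 H1] /poly_boundedP[k2 H2]; apply/poly_boundedP.
exists (k1 + k2).+1 => m; have {}H1 := H1 m; have {}H2 := H2 m.
have h1 : (0 < (m + 2) ^ k1)%N by rewrite expn_gt0 addn2.
have h2 : (0 < (m + 2) ^ k2)%N by rewrite expn_gt0 addn2.
rewrite expnS expnD; nia.
Qed.

Lemma poly_bounded_mul t1 t2 :
  poly_bounded t1 -> poly_bounded t2 -> poly_bounded (fun m => t1 m * t2 m)%N.
Proof.
move=> /poly_boundedP[k1 H1] /poly_boundedP[k2 H2]; apply/poly_boundedP.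
by exists (k1 + k2)%N => m; rewrite expnD leq_mul.
Qed.

Lemma poly_bounded_id : poly_bounded id.
Proof. by exists 1%N => m; rewrite expn1; lia. Qed.

Lemma poly_bounded_const c : poly_bounded (fun=> c).
Proof. by exists c => m; lia. Qed.

Lemma poly_bounded_succ t : poly_bounded t -> poly_bounded (fun m => (t m).+1).
Proof.
by move=> /poly_bounded_add/(_ (poly_bounded_const 1)) [k H]; exists k => m; rewrite -addn1.
Qed.

Lemma poly_bounded_cost c : poly_bounded (cost^~ c).
Proof.
elim: c => [|a e1 e2 e|a e1 e2 e|c1 IH1 c2 IH2|b c1 IH1 c2 IH2|x c IH] /=;
  try exact: poly_bounded_const.
- exact: poly_bounded_add.
- by apply: poly_bounded_succ; apply: poly_bounded_add.
- do 2!apply: poly_bounded_succ; apply: poly_bounded_mul; first exact: poly_bounded_id.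
  by apply: poly_bounded_add IH _; apply: poly_bounded_const.
Qed.

(** * The algorithm *)

Definition init : dprog := DSeq (DFor 12 (DN 3 (reg 12) (NConst 0) (reg 12))) scan.

(* For want of real numerals, the difference r - r stands for 0. *)
Definition round : cmd :=
  Seq (compile rescale)
    (If (BNot (RLe (rreg 1) (RSub (rreg 1) (rreg 1))))
       (Seq (Sample 5 (rreg 1)) (compile sampled_tail))
       (compile tail)).

Definition algorithm : cmd :=
  Seq (compile init) (While (NLe (NConst 1) (reg 16)) round).

Definition round_time (q : nat -> nat) (n : nat) : nat :=
  (cost n rescale + ((q n + n ^ 2).+1 + cost n sampled_tail + cost n tail).+1)%N.

(** The factor [n * (n + 2) + n.+1] bounds the initial measure of the loop. *)
Definition total_time (q : nat -> nat) (n : nat) : nat :=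
  (cost n init + ((n * (n + 2) + n.+1) * (round_time q n).+2).+1)%N.

Lemma poly_bounded_total_time q : poly_bounded q -> poly_bounded (total_time q).
Proof.
move=> pq; have pid := poly_bounded_id.
apply: poly_bounded_add; first exact: poly_bounded_cost.
apply: poly_bounded_succ; apply: poly_bounded_mul.
  apply: poly_bounded_add; last exact: poly_bounded_succ.
  apply: poly_bounded_mul => //; apply: poly_bounded_add => //.
  exact: poly_bounded_const.
do 2!apply: poly_bounded_succ; apply: poly_bounded_add; first exact: poly_bounded_cost.
apply: poly_bounded_succ; apply: poly_bounded_add; last exact: poly_bounded_cost.
apply: poly_bounded_add; last exact: poly_bounded_cost.
apply: poly_bounded_succ; apply: poly_bounded_add => //.
exact: poly_bounded_mul.
Qed.

(** * Termination, correctness and the initial potential *)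

Section Run.
Variables (R : realType) (n : nat) (G : wgraph R 'I_n) (K : {set 'I_n}).
Implicit Types (s : store R).
Hypothesis sym : symmetric (edge G).
Hypothesis lsym : forall u v, edge G u v -> len G u v = len G v u.
Hypothesis len_ge0 : forall u v, edge G u v -> 0 <= len G u v.
Hypothesis conn : connected_graph (edge G).

Notation code := (@nat_of_ord n).
Notation d := (dist G).
Notation out := (output (n := n)).
Local Notation asg := (@asg R n).
Local Notation lab := (@lab R n).

Definition unassigned s : {set 'I_n} := [set v | asg s v == 0%N].

(* The gap bound says that the scale has already been doubled [n.+1 - k] times
   since the last assignment. *)
Definition measured (N : nat) s :=
  [/\ ready G K s, forall t, t \in K -> lab s t = t &
      exists k, [/\ N = (#|unassigned s| * (n + 2) + k)%N, (k <= n.+1)%N &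
        nmem s 16 0 0 != 0%N ->
        k = n.+1 \/ n%:R * gap s <= 2 ^+ k * scale s]].

(** Without a new assignment the gap cannot grow and the scale doubles, so after boundedly many
    rounds [n m <= r], and [ad_prog] forces an assignment. *)
Lemma measured_advance near N s s' r' i j : measured N s ->
  nmem s 16 0 0 != 0%N -> shortest_crossing G s i j ->
  r' = Num.max (scale s + scale s) (gap s) ->
  advance G K near s s' r' i j ->
  exists2 N', (N' < N)%N & measured N' s'.
Proof.
move=> [rdy fix_lab [k [NE kn /[apply] gk]]] sc r'E ad.
have [r0 r'0 rr'] := step_scale rdy r'E.
have rdy' : ready G K s'.
  split; last by move=> t tK; have [_ /(_ _ tK)] := rdy; case/(step_old rdy ad).
  split; rewrite ?(ad_scale ad) //; [exact: ad_input ad|exact: ad_rooted ad| |].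
    exact: ad_within ad.
  exact: ad_scanned ad.
have fix' t : t \in K -> lab s' t = t.
  by move=> tK; have [_ /(_ _ tK) /(ad_old ad)[_ ->]] := rdy; apply: fix_lab.
have sub : unassigned s' \subset unassigned s.
  apply/subsetP => v; rewrite !inE; apply: contraLR => v0.
  by have [-> _] := ad_old ad v0.
have := subset_leq_card sub; rewrite leq_eqVlt => /orP[/eqP eq|lt]; last first.
  (* One unassigned vertex fewer is worth [n + 2], enough to reset [k] to [n.+1]. *)
  exists (#|unassigned s'| * (n + 2) + n.+1)%N; first by rewrite NE; nia.
  by split=> //; exists n.+1; split=> // _; left.
have eqU : unassigned s' = unassigned s by apply/eqP; rewrite eqEcard sub eq leqnn.
have [/and3P[i0 j0 ij] _ gE _] := sc.
have i1 : asg s' i == 0%N by have : i \in unassigned s' by [rewrite eqU inE]; rewrite inE.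
have ngap : ~ n%:R * gap s <= r' by move=> /(ad_prog ad); rewrite i1.
case: k NE kn gk => [|k] NE kn gk.
  by case: gk => // gk; case: ngap; rewrite expr0 mul1r in gk; lra.
exists (#|unassigned s'| * (n + 2) + k)%N; first by rewrite NE eqU; lia.
split=> //; exists k; split=> //; first exact: ltnW.
move=> f1; right; have := ad_scanned ad; rewrite /scanned (negPf f1).
move=> [i' [j' [_ _ _ /(_ i j)]]]; rewrite -gE => le.
have {}le : gap s' <= gap s.
  apply: le; rewrite /crossing i1 ij andbT /=.
  by have [-> _] := ad_old ad j0.
have p0 : 0 < 2 ^+ k :> R by rewrite exprn_gt0.
rewrite (ad_scale ad); apply: (@le_trans _ _ (n%:R * gap s)).
  by rewrite ler_wpM2l.
have gr : gap s <= r' by rewrite r'E le_max lexx orbT.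
(* In the first round after an assignment, the gap is at most [r'] and [n <= 2 ^ n]. *)
case: gk => [[->]|gk].
  apply: ler_pM => //; first exact: gap_ge0 sc.
  by rewrite -natrX ler_nat ltnW // ltn_expl.
apply: le_trans gk _; rewrite exprSr -mulrA ler_pM2l //; lra.
Qed.

Lemma init_lab s v : lab (den n init s) v = v.
Proof.
pose I k s' := forall v : 'I_n, (v < k)%N -> lab s' v = v.
rewrite /init (_ : den n _ s = den n scan (den n (DFor 12 (DN 3 (reg 12) (NConst 0)
  (reg 12))) s)) // lab_frame //.
suff: I n (den n (DFor 12 (DN 3 (reg 12) (NConst 0) (reg 12))) s) by apply.
apply: (den_for (I := I)) => // k s' kn s'k H {}v; rewrite ltnS leq_eqVlt.
case: (eqVneq (v : nat) k) => [vk|nvk] /= lt.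
  by rewrite /lab /= /upd /= s'k vk !eqxx.
by rewrite /lab /= /upd /= s'k (negPf nvk); apply: H.
Qed.

Lemma holds_input_input : holds_input G (input G K).
Proof.
split=> // i j /=; last by rewrite !valK.
congr nat_of_bool; apply/existsP/idP => [[u /existsP[v /and3P[]]]|ij].
  by move=> /eqP/val_inj -> /eqP/val_inj ->.
by exists i; apply/existsP; exists j; rewrite !eqxx.
Qed.

Let start := den n init (input G K).

Lemma asg_start v : asg start v = (v \in K).
Proof.
rewrite /start asg_frame // /asg /=; congr nat_of_bool.
apply/existsP/idP => [[u /andP[uK /eqP/val_inj <-]] //|vK].
by exists v; rewrite vK eqxx.
Qed.

Lemma scale_start : scale start = 0.
Proof. by rewrite /scale /start den_rframe. Qed.

Lemma out_start v : out start v = v.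
Proof. by apply: out_lab; apply: init_lab. Qed.

Lemma ready_start : ready G K start.
Proof.
split; last by move=> t tK; rewrite asg_start tK.
split.
- by apply: holds_input_den => //; apply: holds_input_input.
- move=> v; rewrite asg_start => vK; exists v; rewrite init_lab; split=> //.
  by case: (v \in K) vK.
- by move=> v _; rewrite out_start scale_start distxx // mulr0.
- by rewrite scale_start.
- rewrite /start (_ : den n init _ = den n scan (den n (DFor 12
    (DN 3 (reg 12) (NConst 0) (reg 12))) (input G K))) //.
  by apply: scanned_scan; apply: holds_input_den => //; apply: holds_input_input.
Qed.

Lemma measured_start : measured (#|unassigned start| * (n + 2) + n.+1) start.
Proof.
split; [exact: ready_start|by move=> t _; apply: init_lab|].
by exists n.+1; split=> // _; left.
Qed.

(** With no crossing edge left, being assigned spreads backwards along a walk to a terminal. *)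
Lemma finished_assigned s : K != set0 -> ready G K s -> nmem s 16 0 0 = 0%N ->
  forall v, asg s v != 0%N.
Proof.
move=> /set0Pn[t tK] [[_ _ _ _ scd] Ka] f0 v; move: scd; rewrite /scanned f0 /= => nc.
have /connectP[p vp pt] := conn v t.
elim: p v vp pt => [|w p IH] v /=; first by move=> _ <-; apply: Ka.
move=> /andP[vw wp] wt; have w1 := IH _ wp wt.
by have := nc v w; rewrite /crossing w1 vw /= andbT.
Qed.

(** The walk given by [rooted] has a constant label, so it lies inside the fiber of its terminal. *)
Lemma finished_extension s : ready G K s -> (forall t, t \in K -> lab s t = t) ->
  (forall v, asg s v != 0%N) -> connected_0extension G K (out s).
Proof.
move=> [[_ rt _ _ _] _] fix_lab all1; split.
  split=> [u|t tK]; first by have [] := out_rooted rt (all1 u).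
  by apply: out_lab; apply: fix_lab.
move=> x xK u v ux vx; set e := [rel a b | _].
have e_sym : connect_sym e.
  by apply: sym_connect_sym => a b; rewrite /e /= sym [(out s a == x) && _]andbC.
have to_x w : out s w = x -> connect e w x.
  move=> wx; have [t [_ lw wt]] := rt w (all1 w).
  have tx : t = x by rewrite -wx (out_lab lw).
  rewrite tx in lw wt.
  apply: (connect_restrict (P := fun a => lab s a == x)) wt; last by rewrite lw.
  move=> a b /eqP la /and4P[ab _ _ /eqP lab_eq]; rewrite /e /= ab -lab_eq la eqxx.
  by rewrite (out_lab la) (out_lab (etrans (esym lab_eq) la)) eqxx.
by apply: connect_trans (to_x _ ux) _; rewrite e_sym; apply: to_x.
Qed.

Lemma exists_delta : K != set0 -> exists delta : 'I_n -> 'I_n -> R,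
  (forall (u v w t : 'I_n), w \in [:: u; v] -> t \in K -> delta u v <= d w t) /\
  (forall u v : 'I_n, exists w t : 'I_n,
     [/\ w \in [:: u; v], t \in K & delta u v = d w t]).
Proof.
move=> /set0Pn[t0 t0K].
have /choice[delta H] : forall p : 'I_n * 'I_n, exists x : R,
    (forall w t, w \in [:: p.1; p.2] -> t \in K -> x <= d w t) /\
    exists w t : 'I_n, [/\ w \in [:: p.1; p.2], t \in K & x = d w t].
  move=> [u v] /=; pose P (p : 'I_n * 'I_n) := (p.1 \in [:: u; v]) && (p.2 \in K).
  have P0 : P (u, t0) by rewrite /P /= inE eqxx t0K.
  case: (arg_minP (fun p : 'I_n * 'I_n => d p.1 p.2) P0) => -[w t] /andP[/= wuv tK] min.
  exists (d w t); split; last by exists w, t.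
  by move=> w' t' w'uv t'K; apply: (min (w', t')); rewrite /P /= w'uv.
exists (fun u v => delta (u, v)); split=> [u v|u v]; first exact: (H (u, v)).1.
exact: (H (u, v)).2.
Qed.

Variables (beta : R) (S : sampler R 'I_n) (q : nat -> nat).
Variable (delta : 'I_n -> 'I_n -> R).
Hypothesis beta2 : 2 <= beta.
Hypothesis dec : decomposes_within (q n) d beta S.
Hypothesis delta_le : forall (u v w t : 'I_n), w \in [:: u; v] -> t \in K ->
  delta u v <= d w t.
Hypothesis delta_min : forall u v : 'I_n, exists w t : 'I_n,
  [/\ w \in [:: u; v], t \in K & delta u v = d w t].

Lemma delta_ge0 u v : 0 <= delta u v.
Proof. by have [w [t [_ _ ->]]] := delta_min u v; apply: dist_ge0. Qed.

Definition edge_potential (e : {p : 'I_n * 'I_n | edge G p.1 p.2}) s : R :=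
  potential G beta delta (val e).1 (val e).2 s.

Lemma round_spec N s : measured N s -> beval s (NLe (NConst 1) (reg 16)) ->
  spec S round s (round_time q n)
    (fun s' => exists2 N', (N' < N)%N & measured N' s')
    edge_potential (edge_potential^~ s).
Proof.
set Q := fun s' => _; move=> ms; rewrite [beval _ _]/= lt0n => f1.
have [rdy _ _] := ms; have [so _] := rdy; have [inp rt wi r0 scd] := so.
move: (scd); rewrite /scanned (negPf f1) => -[i [j sc]].
have [r1 g1 N1 R1] := den_rescale n s; set s1 := den n rescale s in r1 g1 N1 R1.
have sn : nmem s 0 0 0 = n by case: inp.
have s1n : nmem s1 0 0 0 = n by rewrite N1.
apply: (spec_seq (Q1 := fun s' => s' = s1) (psi := fun e _ => edge_potential e s)).
  by apply: spec_den.
move=> _ ->; apply: spec_if.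
rewrite [beval _ _]/= subrr -[rmem s1 1 0 0]/(scale s1) -ltNge.
case: ltP => [r'0|r'0]; last first.
  have rE : scale s1 = 0.
    by apply/eqP; rewrite eq_le r'0 r1 le_max; apply/orP; left; lra.
  have ad : advance G K (fun _ _ => false) s (den n tail s1) (scale s1) i j.
    exact: (advance_tail sym lsym len_ge0 conn so sc).
  apply: (@spec_weaken _ _ _ _ _ _ (cost n tail) _ Q _ _ _ _ _ (fun _ => id)); last by lia.
    apply: spec_den => //; first exact: measured_advance ms f1 sc r1 ad.
    move=> [[u v] uv]; rewrite rE in ad r1.
    exact: (advance_zero sym lsym len_ge0 conn beta2 delta_le delta_min rdy sc
      (esym r1) ad uv).
have adP P : 0 < law S (scale s1) P -> advance G K (together P) s
    (den n sampled_tail (write_partition s1 5 P)) (scale s1) i j.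
  have [_ part _] := dec r'0; move=> /part.
  exact: (advance_sampled sym lsym len_ge0 conn so sc).
apply: (@spec_weaken _ _ _ _ _ _
  ((sample_time S (reval s1 (rreg 1)) + n ^ 2).+1 + cost n sampled_tail) _ Q
  _ _ _ _ _ (fun _ => id)).
  (* What follows the draw is deterministic, so the intermediate bound is the potential of the store
     it leads to. *)
  apply: (spec_seq (Q1 := fun s' => exists2 P, 0 < law S (scale s1) P
      & s' = write_partition s1 5 P)
    (psi := fun e s' => edge_potential e (den n sampled_tail s'))).
    apply: spec_sample => //; first by move=> P P0; exists P.
    move=> [[u v] uv].
    exact: (mean_potential sym lsym len_ge0 conn beta2 delta_ge0 delta_le delta_min
         dec rdy sc r1 r'0 adP uv).
  move=> _ [P P0 ->]; apply: spec_den => //.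
  exact: measured_advance ms f1 sc r1 (adP _ P0).
have [st _ _] := dec r'0.
by apply: leq_trans (leq_addr _ _); rewrite leq_add2r ltnS leq_add2r; exact: st.
Qed.

(** The constant is [1022 = 73 * 14], with 14 from [profile0]; the other cases are smaller since
    [ln beta >= 1/2]. *)
Lemma potential_start u v : edge G u v ->
  potential G beta delta u v (den n init (input G K))
    <= 1022 * (beta * ln beta) * len G u v.
Proof.
move=> uv; have b2 := beta2; have l0 := len_ge0 uv.
have lb : 2^-1 <= ln beta.
  by apply: le_trans (ln2_ge R) _; rewrite ler_ln ?posrE //; lra.
have x0 : 0 <= beta * len G u v by rewrite mulr_ge0 //; lra.
have -> : 1022 * (beta * ln beta) * len G u v = 1022 * (beta * len G u v) * ln beta by ring.
have h : (beta * len G u v) * 2^-1 <= beta * len G u v * ln beta by rewrite ler_wpM2l.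
have lx : 2 * len G u v <= beta * len G u v by apply: ler_wpM2r.
have half : half_cost (beta * len G u v) 0 <= 1022 * (beta * len G u v) * ln beta.
  by rewrite /half_cost (max_idPr _); lra.
rewrite /potential !asg_start scale_start !out_start.
case: (u \in K); case: (v \in K) => //=.
  by have := dist_le_edge len_ge0 uv; lra.
have := profile0 beta2 (delta_ge0 u v); move=> /(ler_wpM2l x0).
have -> : 73 * (beta * len G u v) * profile beta (delta u v) 0 =
  73 * (beta * len G u v * profile beta (delta u v) 0) by ring.
lra.
Qed.

Lemma algorithm_spec :
  spec S algorithm (input G K) (total_time q n)
    (fun s => nmem s 16 0 0 = 0%N /\ exists N, measured N s)
    edge_potential (fun e => 1022 * (beta * ln beta) * len G (val e).1 (val e).2).
Proof.
apply: (spec_seq (Q1 := fun s => s = den n init (input G K)) (psi := edge_potential)).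
  by apply: spec_den => // -[[u v] uv]; apply: potential_start.
move=> _ ->.
apply: spec_weaken (spec_while round_spec (measured_start)) _ _.
  rewrite ltnS leq_mul2r; apply/orP; right; rewrite leq_add2r leq_mul2r; apply/orP; right.
  by rewrite -[leqRHS](card_ord n) max_card.
by move=> s []; rewrite [beval _ _]/= lt0n negbK => /eqP.
Qed.

End Run.

Theorem theorem4p1 (R : realType) :
  exists C : R, 0 < C /\
  exists A : cmd,
  forall q : nat -> nat, poly_bounded q ->
  exists p : nat -> nat, poly_bounded p /\
  forall (n : nat) (G : wgraph R 'I_n) (K : {set 'I_n}) (beta : R)
         (S : sampler R 'I_n),
    simple_wgraph G -> connected_graph (edge G) -> K != set0 ->
    2 <= beta ->
    decomposes_within (q n) (dist G) beta S ->
    exists D : outcomes R,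
    [/\ exec S A (input G K) D,
        forall o, List.In o D ->
          (o.2.1 <= p n)%N /\ connected_0extension G K (output o.2.2) &
        forall u v : 'I_n,
          expectation_of D (fun s =>
            dist (ext_graph G (output s)) (output s u) (output s v))
          <= C * (beta * ln beta) * dist G u v].
Proof.
exists 1022; split; first by [].
exists algorithm => q pq; exists (total_time q); split.
  exact: poly_bounded_total_time.
move=> n G K beta S [sym _ lsym len_ge0] conn K0 beta2 dec.
have [delta [delta_le delta_min]] := exists_delta G K0.
have [D [eD HD ED]] := algorithm_spec sym lsym len_ge0 conn beta2 dec delta_le delta_min.
have fin o : List.In o D -> (forall v : 'I_n, asg o.2.2 v != 0%N) /\
    connected_0extension G K (output o.2.2).
  move=> /HD[_ _ [f0 [N [rdy fl _]]]].
  have all1 := finished_assigned conn K0 rdy f0.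
  by split; [|apply: (finished_extension sym rdy)].
exists D; split=> //.
  by move=> o oD; have [_ ext] := fin o oD; have [_ ? _] := HD o oD.
have lb : 0 < ln beta by rewrite ln_gt0 //; lra.
apply: (ext_stretch len_ge0 conn).
- by rewrite !mulr_gt0 //; lra.
- by move=> o /HD[].
move=> u v uv; apply: le_trans (ED (exist _ (u, v) uv)).
apply: le_expectation => o oD; have [o0 _ _] := HD _ oD; split=> //.
(* Once every vertex is assigned, the potential is the distance between the two terminals. *)
by have [all1 _] := fin _ oD; rewrite /edge_potential /potential /= !all1.
Qed.
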